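(* Let $d\ge1$ and $U=U(S_{\rm lazy},\mathcal{P}_{\rm lazy},G_{2d+1})$ acting on $\ell^2(\mathbb{Z}^d,\mathbb{C}^{2d+1})$. Then $1$ is an eigenvalue of $U$ and $U$ has no other eigenvalues. If $\Pi_+$ denotes the orthogonal projection onto the eigenspace of $U$ for eigenvalue $1$, then for every $\phi\in\mathbb{C}^{2d+1}$ and $x\in\mathbb{Z}^d$, $$\lim_{n\to\infty}p_n(\phi;x)=\|\Pi_+(\delta_0\otimes\phi)(x)\|^2_{\mathbb{C}^{2d+1}}.$$
   Context: Let $u_1,\dots,u_d$ be the standard basis of $\mathbb{Z}^d$, $\mathbf{e}_1,\dots,\mathbf{e}_{2d+1}$ the standard basis of $\mathbb{C}^{2d+1}$, $P_j$ the orthogonal projection onto $\mathbb{C}\mathbf{e}_j$. $S_{\rm lazy}=\{0,\pm u_1,\dots,\pm u_d\}$ and $\mathcal{P}_{\rm lazy}=\{P_\alpha\}_{\alpha\in S_{\rm lazy}}$ with $P_{u_j}=P_j$, $P_0=P_{d+1}$, $P_{-u_j}=P_{d+1+j}$ ($j=1,\dots,d$). For $\alpha\in\mathbb{Z}^d$, $(\tau^\alpha f)(x)=f(x-\alpha)$. For a unitary matrix $C$ acting pointwise, $U(S_{\rm lazy},\mathcal{P}_{\rm lazy},C)=\big(\sum_{\alpha\in S_{\rm lazy}}\tau^\alpha P_\alpha\big)C$. $G_D=\frac2DJ-I$ with $J$ the all-ones $D\times D$ matrix. $\delta_0\otimes\phi$ equals $\phi$ at $0$ and $0$ elsewhere,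 and $p_n(\phi;x)=\|U^n(\delta_0\otimes\phi)(x)\|^2$. *)

(* Defs.v *)
From Stdlib Require Import Reals ZArith List.
Import ListNotations.
Open Scope R_scope.

Record Cx := mkCx { Re : R; Im : R }.
Definition Czero : Cx := mkCx 0 0.
Definition Cone : Cx := mkCx 1 0.
Definition Cadd (a b : Cx) : Cx := mkCx (Re a + Re b) (Im a + Im b).
Definition Copp (a : Cx) : Cx := mkCx (- Re a) (- Im a).
Definition Csub (a b : Cx) : Cx := Cadd a (Copp b).
Definition Cmul (a b : Cx) : Cx :=
  mkCx (Re a * Re b - Im a * Im b) (Re a * Im b + Im a * Re b).
Definition Cscale (r : R) (a : Cx) : Cx := mkCx (r * Re a) (r * Im a).
Definition Cconj (a : Cx) : Cx := mkCx (Re a) (- Im a).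
Definition Cnorm2 (a : Cx) : R := Re a * Re a + Im a * Im a.

Fixpoint sumR (n : nat) (f : nat -> R) : R :=
  match n with O => 0 | S k => sumR k f + f k end.
Fixpoint sumC (n : nat) (f : nat -> Cx) : Cx :=
  match n with O => Czero | S k => Cadd (sumC k f) (f k) end.

(* A point of Z^d is a list of integers of length d; a vector of C^D is a
   function nat -> Cx of which only components 0..D-1 matter
   (component j here is e_{j+1} of the paper). *)
Definition valid (d : nat) (x : list Z) : Prop := length x = d.
Definition Dim (d : nat) : nat := (2 * d + 1)%nat.
Definition vec := nat -> Cx.
Definition state := list Z -> vec.

Definition vnorm2 (D : nat) (v : vec) : R := sumR D (fun j => Cnorm2 (v j)).

Fixpoint upd (x : list Z) (k : nat) (c : Z) : list Z :=
  match x, k with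
  | nil, _ => nil
  | a :: t, O => (a + c)%Z :: t
  | a :: t, S k' => a :: upd t k' c
  end.

Definition origin (d : nat) : list Z := repeat 0%Z d.

Definition grover (D : nat) (v : vec) : vec :=
  fun j => Csub (Cscale (2 / INR D) (sumC D v)) (v j).

(* x - alpha_j where alpha_j is the shift attached to component j:
   j < d : alpha = u_{j+1};  j = d : alpha = 0;  j = d+1+k : alpha = -u_{k+1}. *)
Definition pre (d : nat) (x : list Z) (j : nat) : list Z :=
  if Nat.ltb j d then upd x j (-1)%Z
  else if Nat.eqb j d then x
  else upd x (j - d - 1) 1%Z.

(* U = (sum_alpha tau^alpha P_alpha) G_{2d+1}:  (U psi)(x)_j = (G psi(x - alpha_j))_j *)
Definition Ulazy (d : nat) (psi : state) : state :=
  fun x j => grover (Dim d) (psi (pre d x j)) j.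

Definition Uiter (d : nat) (n : nat) (psi : state) : state :=
  Nat.iter n (Ulazy d) psi.

Definition delta0 (d : nat) (phi : vec) : state :=
  fun x => if list_eq_dec Z.eq_dec x (origin d) then phi else (fun _ => Czero).

Definition finset_pts (d : nat) (L : list (list Z)) : Prop :=
  NoDup L /\ Forall (valid d) L.

Fixpoint sumL (F : list Z -> R) (L : list (list Z)) : R :=
  match L with nil => 0 | x :: t => F x + sumL F t end.

Definition has_sum (d : nat) (F : list Z -> R) (s : R) : Prop :=
  forall eps, eps > 0 -> exists L0, finset_pts d L0 /\
    forall L, finset_pts d L -> incl L0 L -> Rabs (sumL F L - s) < eps.

Definition l2 (d : nat) (psi : state) : Prop :=
  exists M, forall L, finset_pts d L -> sumL (fun x => vnorm2 (Dim d) (psi x)) L <= M.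

Definition inner_is (d : nat) (f g : state) (z : Cx) : Prop :=
  has_sum d (fun x => Re (sumC (Dim d) (fun j => Cmul (f x j) (Cconj (g x j))))) (Re z) /\
  has_sum d (fun x => Im (sumC (Dim d) (fun j => Cmul (f x j) (Cconj (g x j))))) (Im z).

Definition eigenspace (d : nat) (lam : Cx) (psi : state) : Prop :=
  l2 d psi /\ forall x j, valid d x -> (j < Dim d)%nat ->
    Ulazy d psi x j = Cmul lam (psi x j).

Definition is_eigenvalue (d : nat) (lam : Cx) : Prop :=
  exists psi, eigenspace d lam psi /\
    exists x j, valid d x /\ (j < Dim d)%nat /\ psi x j <> Czero.

Definition is_orth_proj (d : nat) (E : state -> Prop) (f g : state) : Prop :=
  E g /\ forall e, E e -> inner_is d (fun x j => Csub (f x j) (g x j)) e Czero.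

(* Main.v *)
Require Import Defs.
From Stdlib Require Import Reals ZArith List.
From Stdlib Require Import Lra Lia Classical ClassicalEpsilon FunctionalExtensionality
  PropExtensionality Permutation FinFun.
Import ListNotations.
Open Scope R_scope.

(** Write [a(n) = U^n a] for a real square-summable state (the matrix of [U] is real, so real and
    imaginary parts decouple), [m] for the mean of its components, and consider the deviations
    [f_i = (a_i + a_{-i})/2 - m] and [f_0 = a_0 - m].  They satisfy [f_0 + 2 sum_i f_i = 0] and wave
    equations [f_i(n+1) + f_i(n-1) = - (tau_i + tau_i^-1) f_i(n) + K(n)], respectively
    [f_0(n+1) + f_0(n-1) = - 2 f_0(n) + K(n)], with the same forcing [K(n) = m(n-1) - m(n+1)].
    Their odd parts with respect to a coordinate hyperplane admit a positive-commutator (Morawetz)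
    estimate, which forces [f_i(x) - f_i(x - 2 u_i) -> 0]; as the [f_i(n)] are bounded in l2, all
    deviations tend to 0 pointwise.  Feeding this back into the evolution gives
    [U^(n+1) a - U^n a -> 0] pointwise for every square-summable [a].  Applied to an eigenvector
    this leaves only the eigenvalue 1; combined with von Neumann's argument (the point of least norm
    in the closure of [a - ran (U - 1)] is the projection of [a]) it gives the limit of [U^n a].
    An eigenvector for 1 is supported on the cube [{0,1}^d]. *)

(** * Unordered sums over the lattice *)

Lemma sumL_perm F L L' : Permutation L L' -> sumL F L = sumL F L'.
Proof. induction 1; simpl; lra. Qed.

Lemma sumL_map F (phi : list Z -> list Z) L :
  sumL F (map phi L) = sumL (fun x => F (phi x)) L.
Proof. induction L; simpl; lra. Qed.

Lemma sumL_lin a b F G L :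
  sumL (fun x => a * F x + b * G x) L = a * sumL F L + b * sumL G L.
Proof. induction L; simpl; lra. Qed.

Lemma sumL_le d F G L : (forall x, valid d x -> F x <= G x) ->
  Forall (valid d) L -> sumL F L <= sumL G L.
Proof.
  intros H; induction 1 as [|a t Ha Ht IH]; simpl; [lra|].
  specialize (H a Ha); lra.
Qed.

Lemma sumL_ext d F G L : (forall x, valid d x -> F x = G x) ->
  Forall (valid d) L -> sumL F L = sumL G L.
Proof.
  intros H V; apply Rle_antisym; apply sumL_le with d; auto;
  intros x Hx; rewrite (H x Hx); lra.
Qed.

Lemma sumL_incl d F : (forall x, valid d x -> 0 <= F x) ->
  forall L L', finset_pts d L -> finset_pts d L' -> incl L L' -> sumL F L <= sumL F L'.
Proof.
  intros HF; induction L as [|a t IH]; intros L' [HN HV] [HN' HV'] I; simpl.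
  - replace 0 with (sumL (fun _ => 0) L').
    + apply sumL_le with d; auto.
    + clear; induction L'; simpl; lra.
  - destruct (in_split a L') as [l1 [l2 E]]; [apply I; now left|].
    assert (P : Permutation L' (a :: l1 ++ l2))
      by (subst; symmetry; apply Permutation_middle).
    rewrite (sumL_perm F _ _ P); simpl.
    apply Rplus_le_compat_l.
    inversion HN; inversion HV; subst.
    apply (Permutation_NoDup P) in HN'.
    apply (Permutation_Forall P) in HV'.
    inversion HN'; inversion HV'; subst.
    apply IH; try (split; assumption).
    intros y Hy.
    assert (Hy' : In y (a :: l1 ++ l2)).
    { eapply Permutation_in; [exact P|]. apply I; now right. }
    destruct Hy' as [->|]; [contradiction|assumption].
Qed.

Lemma finset_union d L L' : finset_pts d L -> finset_pts d L' ->
  exists M, finset_pts d M /\ incl L M /\ incl L' M.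
Proof.
  intros [_ V] [_ V'].
  exists (nodup (list_eq_dec Z.eq_dec) (L ++ L')); repeat split.
  - apply NoDup_nodup.
  - apply Forall_forall; intros x Hx; apply nodup_In, in_app_or in Hx.
    rewrite Forall_forall in V, V'; destruct Hx; auto.
  - intros x Hx; apply nodup_In, in_or_app; auto.
  - intros x Hx; apply nodup_In, in_or_app; auto.
Qed.

Lemma has_sum_unique d F s t : has_sum d F s -> has_sum d F t -> s = t.
Proof.
  intros Hs Ht.
  destruct (Req_dec s t) as [|N]; [assumption|exfalso].
  assert (P : Rabs (s - t) / 2 > 0).
  { assert (0 < Rabs (s - t)) by (apply Rabs_pos_lt; lra); lra. }
  destruct (Hs _ P) as [L [FL HL]], (Ht _ P) as [L' [FL' HL']].
  destruct (finset_union d L L' FL FL') as [M [FM [I I']]].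
  specialize (HL M FM I); specialize (HL' M FM I').
  assert (Rabs (s - t) <= Rabs (sumL F M - s) + Rabs (sumL F M - t)).
  { replace (s - t) with (- (sumL F M - s) + (sumL F M - t)) by lra.
    eapply Rle_trans; [apply Rabs_triang|]. rewrite Rabs_Ropp; lra. }
  lra.
Qed.

Lemma has_sum_ext d F G s : (forall x, valid d x -> F x = G x) ->
  has_sum d F s -> has_sum d G s.
Proof.
  intros E H eps He; destruct (H eps He) as [L [FL HL]].
  exists L; split; [assumption|]; intros M FM I.
  rewrite <- (sumL_ext d F G M E); [now apply HL|apply FM].
Qed.

Lemma has_sum_lin d a b F G s t : has_sum d F s -> has_sum d G t ->
  has_sum d (fun x => a * F x + b * G x) (a * s + b * t).
Proof.
  intros Hs Ht eps He.
  assert (Pa : 0 < Rabs a + Rabs b + 1)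
    by (generalize (Rabs_pos a) (Rabs_pos b); lra).
  assert (P : eps / (Rabs a + Rabs b + 1) > 0) by (apply Rdiv_lt_0_compat; lra).
  destruct (Hs _ P) as [L [FL HL]], (Ht _ P) as [L' [FL' HL']].
  destruct (finset_union d L L' FL FL') as [M [FM [I I']]].
  exists M; split; [assumption|]; intros N FN IN.
  specialize (HL N FN (fun x h => IN x (I x h))).
  specialize (HL' N FN (fun x h => IN x (I' x h))).
  rewrite sumL_lin.
  replace (_ - _) with (a * (sumL F N - s) + b * (sumL G N - t)) by ring.
  eapply Rle_lt_trans; [apply Rabs_triang|]; rewrite !Rabs_mult.
  set (e := eps / _) in *.
  assert (E : eps = e * (Rabs a + Rabs b + 1)) by (unfold e; field; lra).
  assert (Rabs a * Rabs (sumL F N - s) <= Rabs a * e)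
    by (apply Rmult_le_compat_l; [apply Rabs_pos|lra]).
  assert (Rabs b * Rabs (sumL G N - t) <= Rabs b * e)
    by (apply Rmult_le_compat_l; [apply Rabs_pos|lra]).
  rewrite E; nra.
Qed.

Lemma has_sum_bij d F s (phi psi : list Z -> list Z) :
  (forall x, valid d x -> valid d (phi x)) -> (forall x, valid d x -> valid d (psi x)) ->
  (forall x, psi (phi x) = x) -> (forall x, phi (psi x) = x) ->
  has_sum d F s -> has_sum d (fun x => F (phi x)) s.
Proof.
  intros V V' C C' H eps He; destruct (H eps He) as [L [[NL VL] HL]].
  assert (T : forall (f g : list Z -> list Z) K, (forall x, valid d x -> valid d (f x)) ->
     (forall x, g (f x) = x) -> finset_pts d K -> finset_pts d (map f K)).
  { intros f g K Vf Cf [NK VK]; split.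
    - apply Injective_map_NoDup; [|assumption].
      intros x y E; rewrite <- (Cf x), <- (Cf y), E; reflexivity.
    - apply Forall_map; eapply Forall_impl; [|exact VK]; exact Vf. }
  exists (map psi L); split; [apply T with phi; auto; now split|].
  intros M FM I; rewrite <- sumL_map; apply HL; [apply T with psi; auto|].
  intros x Hx; rewrite <- (C' x); apply in_map, I, in_map, Hx.
Qed.

Lemma has_sum_ge d F s L : (forall x, valid d x -> 0 <= F x) ->
  has_sum d F s -> finset_pts d L -> sumL F L <= s.
Proof.
  intros P H FL; apply Rnot_lt_le; intros N.
  destruct (H (sumL F L - s)) as [L0 [F0 H0]]; [lra|].
  destruct (finset_union d L L0 FL F0) as [M [FM [I I0]]].
  specialize (H0 M FM I0); apply Rabs_def2 in H0.
  pose proof (sumL_incl d F P L M FL FM I); lra.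
Qed.

Lemma has_sum_upper d F s C : (forall L, finset_pts d L -> sumL F L <= C) ->
  has_sum d F s -> s <= C.
Proof.
  intros B H; apply Rnot_lt_le; intros N.
  destruct (H (s - C)) as [L [FL HL]]; [lra|].
  specialize (HL L FL (incl_refl L)); apply Rabs_def2 in HL.
  specialize (B L FL); lra.
Qed.

Definition summable (d : nat) (F : list Z -> R) : Prop := exists s, has_sum d F s.
(** A total function, so that sums can be rewritten like ordinary expressions; the value is
    meaningful only for summable families. *)
Definition tsum (d : nat) (F : list Z -> R) : R := epsilon (inhabits 0) (has_sum d F).

Lemma tsum_spec d F : summable d F -> has_sum d F (tsum d F).
Proof. apply epsilon_spec. Qed.

Lemma tsum_eq d F s : has_sum d F s -> tsum d F = s.
Proof. intros H; apply has_sum_unique with d F; [apply tsum_spec; now exists s|assumption]. Qed.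

Lemma tsum_lin d a b F G : summable d F -> summable d G ->
  tsum d (fun x => a * F x + b * G x) = a * tsum d F + b * tsum d G.
Proof. intros HF HG; apply tsum_eq, has_sum_lin; now apply tsum_spec. Qed.

Lemma summable_bounded d F C : (forall x, valid d x -> 0 <= F x) ->
  (forall L, finset_pts d L -> sumL F L <= C) -> summable d F.
Proof.
  intros P B.
  destruct (completeness (fun r => exists L, finset_pts d L /\ r = sumL F L)) as [s [U Lst]].
  - exists C; intros r [L [FL ->]]; auto.
  - exists 0, nil; repeat split; constructor.
  - exists s; intros eps He.
    destruct (classic (exists L, finset_pts d L /\ s - eps < sumL F L)) as [[L [FL HL]]|N].
    + exists L; split; [assumption|]; intros M FM I.
      pose proof (sumL_incl d F P L M FL FM I).
      assert (sumL F M <= s) by (apply U; now exists M).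
      apply Rabs_def1; lra.
    + exfalso; assert (s <= s - eps); [|lra].
      apply Lst; intros r [L [FL ->]]; apply Rnot_lt_le; intros H; apply N; now exists L.
Qed.

Lemma summable_lin d a b F G : summable d F -> summable d G ->
  summable d (fun x => a * F x + b * G x).
Proof. intros [s Hs] [t Ht]; eexists; apply has_sum_lin; eassumption. Qed.

Lemma summable_ext d F G : (forall x, valid d x -> F x = G x) -> summable d F -> summable d G.
Proof. intros E [s Hs]; exists s; eapply has_sum_ext; eassumption. Qed.

(** Covers divergent families as well: [has_sum d F] and [has_sum d G] are equal predicates, so
    [epsilon] picks the same value for both. *)
Lemma tsum_ext d F G : (forall x, valid d x -> F x = G x) -> tsum d F = tsum d G.
Proof.
  intros E; unfold tsum; f_equal; apply functional_extensionality; intros s.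
  apply propositional_extensionality; split;
  apply has_sum_ext; auto using eq_sym.
Qed.

Lemma summable_le d F G : (forall x, valid d x -> 0 <= F x <= G x) ->
  summable d G -> summable d F.
Proof.
  intros B [s Hs]; apply summable_bounded with s; [intros; now apply B|].
  intros L FL; apply Rle_trans with (sumL G L).
  - apply sumL_le with d; [intros; now apply B|apply FL].
  - apply has_sum_ge with d; auto; intros x Hx; specialize (B x Hx); lra.
Qed.

Lemma summable_abs_le d F G : (forall x, valid d x -> Rabs (F x) <= G x) ->
  summable d G -> summable d F.
Proof.
  intros B HG.
  (* Write [F = (F + G) - G], where [0 <= F + G <= 2 G]. *)
  apply summable_ext with (fun x => 1 * (F x + G x) + (-1) * G x); [intros; ring|].
  apply summable_lin; [|assumption].
  apply summable_le with (fun x => 1 * G x + 1 * G x).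
  - intros x Hx; specialize (B x Hx).
    pose proof (Rle_abs (F x)); pose proof (Rle_abs (- F x)); rewrite Rabs_Ropp in *; lra.
  - now apply summable_lin.
Qed.

Lemma tsum_nonneg_ge d F L : (forall x, valid d x -> 0 <= F x) -> summable d F ->
  finset_pts d L -> sumL F L <= tsum d F.
Proof. intros P H; apply has_sum_ge; [assumption|now apply tsum_spec]. Qed.

Lemma tsum_ge0 d F : (forall x, valid d x -> 0 <= F x) -> summable d F -> 0 <= tsum d F.
Proof.
  intros P H; apply (tsum_nonneg_ge d F nil P H); split; constructor.
Qed.

Lemma tsum_bij d F (phi psi : list Z -> list Z) :
  (forall x, valid d x -> valid d (phi x)) -> (forall x, valid d x -> valid d (psi x)) ->
  (forall x, psi (phi x) = x) -> (forall x, phi (psi x) = x) ->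
  summable d F -> tsum d (fun x => F (phi x)) = tsum d F.
Proof.
  intros V V' C C' H; apply tsum_eq; apply has_sum_bij with psi; auto; now apply tsum_spec.
Qed.

(** * Square-summable fields *)

Definition field := list Z -> R.
Definition lin (a : R) (f : field) (b : R) (g : field) : field := fun x => a * f x + b * g x.
Definition pull (f : field) (phi : list Z -> list Z) : field := fun x => f (phi x).
Definition mul (s f : field) : field := fun x => s x * f x.
Definition fsum (n : nat) (f : nat -> field) : field := fun x => sumR n (fun i => f i x).

Definition square_summable (d : nat) (f : field) : Prop := summable d (fun x => f x * f x).
Definition ip (d : nat) (f g : field) : R := tsum d (fun x => f x * g x).

Definition bijective_on (d : nat) (phi psi : list Z -> list Z) : Prop :=
  (forall x, valid d x -> valid d (phi x)) /\ (forall x, valid d x -> valid d (psi x)) /\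
  (forall x, psi (phi x) = x) /\ (forall x, phi (psi x) = x).

Lemma summable_mul d f g : square_summable d f -> square_summable d g ->
  summable d (fun x => f x * g x).
Proof.
  intros Hf Hg.
  apply summable_abs_le with (fun x => 1 * (f x * f x) + 1 * (g x * g x)).
  - intros x _; apply Rabs_le; split; nra.
  - now apply summable_lin.
Qed.

Lemma square_summable_lin d a f b g : square_summable d f -> square_summable d g ->
  square_summable d (lin a f b g).
Proof.
  intros Hf Hg.
  apply summable_ext with (fun x => 1 * (a * a * (f x * f x) + 2 * a * b * (f x * g x))
    + b * b * (g x * g x)); [intros; unfold lin; ring|].
  apply summable_lin; [apply summable_lin|]; auto using summable_mul.
Qed.

Lemma summable_bij d F phi psi : bijective_on d phi psi -> summable d F ->
  summable d (fun x => F (phi x)).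
Proof. intros (V & V' & C & C') [s Hs]; exists s; now apply has_sum_bij with psi. Qed.

Lemma square_summable_pull d f phi psi : bijective_on d phi psi -> square_summable d f ->
  square_summable d (pull f phi).
Proof. intros Hb; apply (summable_bij d (fun x => f x * f x) phi psi Hb). Qed.

Lemma square_summable_mul d s f : (forall x, -1 <= s x <= 1) -> square_summable d f ->
  square_summable d (mul s f).
Proof.
  intros B; apply summable_le; intros x _; unfold mul.
  specialize (B x).
  assert (0 <= f x * f x) by nra. assert (0 <= s x * s x <= 1) by nra. nra.
Qed.

Lemma square_summable_zero d : square_summable d (fun _ => 0).
Proof.
  apply summable_bounded with 0; [intros; lra|].
  intros L _; induction L; simpl; lra.
Qed.

Lemma square_summable_ext d f g : (forall x, valid d x -> f x = g x) ->
  square_summable d f -> square_summable d g.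
Proof. intros E; apply summable_ext; intros x Hx; now rewrite (E x Hx). Qed.

Lemma square_summable_fsum d n f : (forall i, (i < n)%nat -> square_summable d (f i)) ->
  square_summable d (fsum n f).
Proof.
  induction n as [|n IH]; intros H; [apply square_summable_zero|].
  apply square_summable_ext with (lin 1 (fsum n f) 1 (f n)).
  - intros; unfold lin, fsum; simpl; ring.
  - apply square_summable_lin; auto.
Qed.

Lemma ip_sym d f g : ip d f g = ip d g f.
Proof. apply tsum_ext; intros; ring. Qed.

Lemma ip_ext d f f' g g' : (forall x, valid d x -> f x = f' x) ->
  (forall x, valid d x -> g x = g' x) -> ip d f g = ip d f' g'.
Proof. intros E E'; apply tsum_ext; intros; now rewrite E, E'. Qed.

Lemma ip_linl d a f b g h : square_summable d f -> square_summable d g -> square_summable d h ->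
  ip d (lin a f b g) h = a * ip d f h + b * ip d g h.
Proof.
  intros; unfold ip; rewrite <- tsum_lin by auto using summable_mul.
  apply tsum_ext; intros; unfold lin; ring.
Qed.

Lemma ip_linr d a f b g h : square_summable d f -> square_summable d g -> square_summable d h ->
  ip d h (lin a f b g) = a * ip d h f + b * ip d h g.
Proof. intros; rewrite ip_sym, ip_linl, !(ip_sym d h); auto. Qed.

Lemma ip_zero_l d h : ip d (fun _ => 0) h = 0.
Proof.
  apply tsum_eq; intros eps He; exists nil; repeat split; try constructor.
  intros L _ _; replace (sumL _ L - 0) with 0; [now rewrite Rabs_R0|].
  induction L; simpl; lra.
Qed.

Lemma ip_fsuml d n f h : (forall i, (i < n)%nat -> square_summable d (f i)) -> square_summable d h ->
  ip d (fsum n f) h = sumR n (fun i => ip d (f i) h).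
Proof.
  intros Hf Hh; induction n as [|n IH]; [apply ip_zero_l|]; simpl.
  rewrite <- IH by auto.
  transitivity (ip d (lin 1 (fsum n f) 1 (f n)) h).
  - apply ip_ext; auto; intros; unfold lin, fsum; simpl; ring.
  - rewrite ip_linl; auto using square_summable_fsum; ring.
Qed.

Lemma ip_pull d f g phi psi : bijective_on d phi psi -> square_summable d f -> square_summable d g ->
  ip d (pull f phi) (pull g phi) = ip d f g.
Proof.
  intros (V & V' & C & C') Hf Hg.
  apply (tsum_bij d (fun x => f x * g x) phi psi); auto using summable_mul.
Qed.

Lemma ip_ge_list d f L : square_summable d f -> finset_pts d L ->
  sumL (fun x => f x * f x) L <= ip d f f.
Proof. intros; apply tsum_nonneg_ge; auto; intros; nra. Qed.

Lemma ip_ge0 d f : square_summable d f -> 0 <= ip d f f.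
Proof. intros; apply tsum_ge0; auto; intros; nra. Qed.

Lemma ip_ge_pt d f x : square_summable d f -> valid d x -> f x * f x <= ip d f f.
Proof.
  intros Hf Hx; pose proof (ip_ge_list d f [x] Hf) as H; simpl in H.
  rewrite Rplus_0_r in H; apply H; repeat constructor; [simpl; tauto|assumption].
Qed.

(** Expand the squares of [f + g] and [f - g], both nonnegative. This weak form of Cauchy-Schwarz is
    enough to bound the momenta below. *)
Lemma ip_abs_le d f g : square_summable d f -> square_summable d g ->
  2 * Rabs (ip d f g) <= ip d f f + ip d g g.
Proof.
  intros Hf Hg.
  pose proof (ip_ge0 d (lin 1 f 1 g) (square_summable_lin d 1 f 1 g Hf Hg)) as P.
  pose proof (ip_ge0 d (lin 1 f (-1) g) (square_summable_lin d 1 f (-1) g Hf Hg)) as Q.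
  rewrite ip_linl, !ip_linr, (ip_sym d g f) in P, Q by auto using square_summable_lin.
  unfold Rabs; destruct (Rcase_abs (ip d f g)); lra.
Qed.

(** Nonnegativity of the square of [a f - b g] bounds the cross term. *)
Lemma ip_lin_sq d a f b g : square_summable d f -> square_summable d g ->
  ip d (lin a f b g) (lin a f b g) <= 2 * a * a * ip d f f + 2 * b * b * ip d g g.
Proof.
  intros Hf Hg.
  pose proof (ip_ge0 d (lin a f (-b) g) (square_summable_lin d a f (-b) g Hf Hg)) as Q.
  rewrite ip_linl, !ip_linr, (ip_sym d g f) in * by auto using square_summable_lin. nra.
Qed.

Definition bounded_seq (d : nat) (u : nat -> field) : Prop :=
  exists C, forall n, square_summable d (u n) /\ ip d (u n) (u n) <= C.

Lemma bounded_lin d a u b v : bounded_seq d u -> bounded_seq d v ->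
  bounded_seq d (fun n => lin a (u n) b (v n)).
Proof.
  intros [C HC] [C' HC']; exists (2 * a * a * C + 2 * b * b * C'); intros n.
  destruct (HC n) as [Hu Bu], (HC' n) as [Hv Bv]; split.
  - now apply square_summable_lin.
  - eapply Rle_trans; [now apply ip_lin_sq|].
    assert (0 <= a * a) by nra. assert (0 <= b * b) by nra. nra.
Qed.

Lemma bounded_pull d u phi psi : bijective_on d phi psi -> bounded_seq d u ->
  bounded_seq d (fun n => pull (u n) phi).
Proof.
  intros Hb [C HC]; exists C; intros n; destruct (HC n) as [Hu Bu]; split.
  - eapply square_summable_pull; eassumption.
  - erewrite ip_pull; eassumption.
Qed.

Lemma bounded_mul d s u : (forall x, -1 <= s x <= 1) -> bounded_seq d u ->
  bounded_seq d (fun n => mul s (u n)).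
Proof.
  intros B [C HC]; exists C; intros n; destruct (HC n) as [Hu Bu]; split.
  - now apply square_summable_mul.
  - apply Rle_trans with (ip d (u n) (u n)); [|assumption].
    apply has_sum_upper with d (fun x => mul s (u n) x * mul s (u n) x).
    + intros L FL; apply Rle_trans with (sumL (fun x => u n x * u n x) L); [|now apply ip_ge_list].
      apply sumL_le with d; [|apply FL].
      intros x _; unfold mul; specialize (B x).
      assert (0 <= u n x * u n x) by nra. assert (0 <= s x * s x <= 1) by nra. nra.
    + apply tsum_spec, (square_summable_mul d s (u n)); auto.
Qed.

Lemma bounded_fsum d N (u : nat -> nat -> field) :
  (forall i, (i < N)%nat -> bounded_seq d (u i)) ->
  bounded_seq d (fun n => fsum N (fun i => u i n)).
Proof.
  induction N as [|N IH]; intros H.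
  - exists 0; intros n; split; [apply square_summable_zero|].
    unfold fsum; simpl; rewrite ip_zero_l; lra.
  - assert (E : (fun n => fsum (S N) (fun i => u i n)) =
       fun n => lin 1 (fsum N (fun i => u i n)) 1 (u N n)).
    { apply functional_extensionality; intros n; apply functional_extensionality; intros x.
      unfold lin, fsum; simpl; ring. }
    rewrite E; apply bounded_lin; auto.
Qed.

Lemma bounded_shift d u : bounded_seq d u -> bounded_seq d (fun n => u (n + 1)%nat).
Proof. intros [C H]; exists C; intros n; apply H. Qed.

Lemma bounded_square_summable d u n : bounded_seq d u -> square_summable d (u n).
Proof. intros [C H]; apply H. Qed.

(** * Null sequences and translations *)

Lemma sumR_ext n f g : (forall i, (i < n)%nat -> f i = g i) -> sumR n f = sumR n g.
Proof. induction n; intros H; simpl; [reflexivity|]. rewrite IHn, H by auto; reflexivity. Qed.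

Lemma sumR_lin n a b f g : sumR n (fun i => a * f i + b * g i) = a * sumR n f + b * sumR n g.
Proof. induction n; simpl; lra. Qed.

Lemma sumR_le n f g : (forall i, (i < n)%nat -> f i <= g i) -> sumR n f <= sumR n g.
Proof. induction n; intros H; simpl; [lra|]. apply Rplus_le_compat; auto. Qed.

Lemma sumR_const n c : sumR n (fun _ => c) = INR n * c.
Proof. induction n; [simpl; lra|]. rewrite S_INR; simpl sumR; lra. Qed.

Lemma sumR_ge_term n f k : (forall i, (i < n)%nat -> 0 <= f i) -> (k < n)%nat -> f k <= sumR n f.
Proof.
  induction n as [|n IH]; intros H Hk; [lia|]; simpl.
  assert (0 <= sumR n f).
  { replace 0 with (sumR n (fun _ => 0)) by (rewrite sumR_const; lra). apply sumR_le; auto. }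
  destruct (Nat.eq_dec k n) as [->|N]; [lra|].
  assert (f k <= sumR n f) by (apply IH; auto; lia).
  assert (0 <= f n) by auto. lra.
Qed.

Lemma Rabs_lt_of_sqr a eps : 0 < eps -> a * a < eps * eps -> Rabs a < eps.
Proof. intros; apply Rabs_def1; nra. Qed.

Definition null (u : nat -> R) : Prop := Un_cv u 0.

Lemma null_ext u v : (forall n, u n = v n) -> null u -> null v.
Proof. intros E H eps He; destruct (H eps He) as [N HN]; exists N; intros; rewrite <- E; auto. Qed.

Lemma null_zero : null (fun _ => 0).
Proof. intros eps He; exists 0%nat; intros; unfold Rdist; rewrite Rminus_0_r, Rabs_R0; assumption. Qed.

Lemma cv_scal a u l : Un_cv u l -> Un_cv (fun n => a * u n) (a * l).
Proof.
  intros H; apply (CV_mult (fun _ => a) u a l); [|assumption].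
  intros eps He; exists 0%nat; intros; unfold Rdist; rewrite Rminus_diag, Rabs_R0; assumption.
Qed.

Lemma null_lin a u b v : null u -> null v -> null (fun n => a * u n + b * v n).
Proof.
  intros Hu Hv; unfold null; replace 0 with (a * 0 + b * 0) by ring.
  apply (CV_plus (fun n => a * u n) (fun n => b * v n)); now apply cv_scal.
Qed.

Lemma null_shift u : null u -> null (fun n => u (n + 1)%nat).
Proof.
  intros H eps He; destruct (H eps He) as [N HN]; exists N; intros; apply HN; lia.
Qed.

Lemma null_unshift u : null (fun n => u (n + 1)%nat) -> null u.
Proof.
  intros H eps He; destruct (H eps He) as [N HN]; exists (N + 1)%nat; intros n Hn.
  replace n with (n - 1 + 1)%nat by lia; apply HN; lia.
Qed.

Lemma null_mul_self u : null u -> null (fun n => u n * u n).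
Proof. intros H; unfold null; replace 0 with (0 * 0) by ring; now apply CV_mult. Qed.

Lemma null_sumR K (u : nat -> nat -> R) : (forall m, (m < K)%nat -> null (u m)) ->
  null (fun n => sumR K (fun m => u m n)).
Proof.
  induction K as [|K IH]; intros H; [apply null_zero|].
  apply null_ext with (fun n => 1 * sumR K (fun m => u m n) + 1 * u K n); [intros; simpl; ring|].
  apply null_lin; auto.
Qed.

(** [M] is nondecreasing and bounded, hence convergent; its increments therefore tend to 0, and they
    dominate the squares. *)
Lemma null_of_increments M a C : (forall n, Rabs (M n) <= C) ->
  (forall n, a n * a n <= M (n + 1)%nat - M n) -> null a.
Proof.
  intros B I.
  assert (G : Un_growing M).
  { intros n; specialize (I n); replace (S n) with (n + 1)%nat by lia; nra. }
  assert (U : has_ub M).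
  { exists C; intros r [n ->]; specialize (B n); pose proof (Rle_abs (M n)); lra. }
  destruct (growing_cv M G U) as [l Hl].
  intros eps He.
  destruct (Hl (eps * eps / 2)) as [N HN]; [nra|].
  exists N; intros n Hn.
  pose proof (HN n Hn) as H1; pose proof (HN (n + 1)%nat ltac:(lia)) as H2.
  unfold Rdist in *; rewrite Rminus_0_r.
  apply Rabs_def2 in H1, H2; specialize (I n).
  apply Rabs_lt_of_sqr; lra.
Qed.

(** For large [n] the first [K] entries of row [n] are almost equal while their squares add up to at
    most [C], so each is of order at most [sqrt (C / K)]; and [K] is arbitrary. *)
Lemma null_of_translates (a : nat -> nat -> R) C :
  (forall n K, sumR K (fun m => a n m * a n m) <= C) ->
  (forall m, null (fun n => a n (m + 1)%nat - a n m)) -> null (fun n => a n 0%nat).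
Proof.
  intros B T.
  assert (T0 : forall m, null (fun n => a n m - a n 0%nat)).
  { induction m as [|m IH]; [apply null_ext with (fun _ => 0); [intros; ring|apply null_zero]|].
    apply null_ext with (fun n => 1 * (a n (m + 1)%nat - a n m) + 1 * (a n m - a n 0%nat)).
    - intros n; replace (m + 1)%nat with (S m) by lia; ring.
    - apply null_lin; auto. }
  assert (C0 : 0 <= C) by (apply (B 0%nat 0%nat)).
  intros eps He.
  (* [K] satisfies [K eps^2 > 2 C + 2]: the term [2 C] pays for the bound on the squares, the other
     2 for [e n < 1]. *)
  destruct (INR_unbounded ((2 * C + 2) / (eps * eps))) as [K HK].
  set (e := fun n => sumR K (fun m => (a n m - a n 0%nat) * (a n m - a n 0%nat))).
  assert (E : null e) by (apply null_sumR; intros; now apply null_mul_self).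
  destruct (E 1 Rlt_0_1) as [N HN]; exists N; intros n Hn.
  specialize (HN n Hn); unfold Rdist in *; rewrite Rminus_0_r in *.
  apply Rabs_def2 in HN.
  assert (P : INR K * (a n 0%nat * a n 0%nat) <= 2 * C + 2 * e n).
  { rewrite <- sumR_const.
    apply Rle_trans with (sumR K (fun m => 2 * (a n m * a n m)
        + 2 * ((a n m - a n 0%nat) * (a n m - a n 0%nat)))).
    (* [a_0^2 <= 2 a_m^2 + 2 (a_m - a_0)^2], the difference of the two sides being the square of
       [2 a_m - a_0]. *)
    - apply sumR_le; intros m _; pose proof (Rle_0_sqr (2 * a n m - a n 0%nat)); unfold Rsqr in *; nra.
    - rewrite sumR_lin; specialize (B n K); unfold e; lra. }
  assert (Q : 0 < eps * eps) by nra.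
  apply Rmult_gt_compat_r with (r := eps * eps) in HK; [|assumption].
  unfold Rdiv in HK; rewrite Rmult_assoc, Rinv_l in HK by lra.
  pose proof (pos_INR K).
  apply Rabs_lt_of_sqr; [assumption|]; apply Rnot_le_lt; intros L.
  apply (Rmult_le_compat_l (INR K)) in L; lra.
Qed.

(** * Translations and reflections of the lattice *)

Lemma upd_length x k z : length (upd x k z) = length x.
Proof. revert k; induction x; destruct k; simpl; auto. Qed.

Lemma upd_upd x k a b : upd (upd x k a) k b = upd x k (a + b)%Z.
Proof. revert k; induction x; destruct k; simpl; f_equal; auto; lia. Qed.

Lemma upd_zero x k : upd x k 0 = x.
Proof. revert k; induction x; destruct k; simpl; f_equal; auto; lia. Qed.

Lemma upd_comm x i k a b : i <> k -> upd (upd x i a) k b = upd (upd x k b) i a.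
Proof. revert i k; induction x; destruct i, k; simpl; intros; f_equal; auto; congruence. Qed.

Lemma nth_upd_same x k z : (k < length x)%nat -> nth k (upd x k z) 0%Z = (nth k x 0 + z)%Z.
Proof. revert k; induction x; destruct k; simpl; intros; auto; try lia. apply IHx; lia. Qed.

Lemma nth_upd_other x i k z : i <> k -> nth k (upd x i z) 0%Z = nth k x 0%Z.
Proof. revert i k; induction x; destruct i, k; simpl; intros; auto; congruence. Qed.

Lemma upd_out x k z : (length x <= k)%nat -> upd x k z = x.
Proof. revert k; induction x; destruct k; simpl; intros; auto; try lia. f_equal; apply IHx; lia. Qed.

Lemma valid_upd d x k z : valid d x -> valid d (upd x k z).
Proof. unfold valid; now rewrite upd_length. Qed.

Lemma bijective_upd d k z : bijective_on d (fun x => upd x k z) (fun x => upd x k (- z)).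
Proof.
  repeat split; intros; auto using valid_upd; rewrite upd_upd.
  - rewrite Z.add_opp_diag_r; apply upd_zero.
  - rewrite Z.add_opp_diag_l; apply upd_zero.
Qed.

(** Reflection in the hyperplane [x_k = c], written as a displacement so that the lemmas on [upd]
    apply. *)
Definition reflect (k : nat) (c : Z) (x : list Z) : list Z := upd x k (2 * (c - nth k x 0%Z)).

Lemma reflect_involutive k c x : reflect k c (reflect k c x) = x.
Proof.
  unfold reflect; destruct (Nat.lt_ge_cases k (length x)).
  - rewrite nth_upd_same, upd_upd by assumption.
    transitivity (upd x k 0); [f_equal; lia|apply upd_zero].
  - now rewrite !(upd_out x) by assumption.
Qed.

Lemma bijective_reflect d k c : bijective_on d (reflect k c) (reflect k c).
Proof.
  repeat split; intros; auto using reflect_involutive; now apply valid_upd.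
Qed.

Lemma reflect_upd_same d k c x z : (k < d)%nat -> valid d x ->
  reflect k c (upd x k z) = upd (reflect k c x) k (- z).
Proof.
  intros Hk Hx; unfold valid in Hx; unfold reflect; rewrite nth_upd_same, !upd_upd by lia.
  f_equal; lia.
Qed.

Lemma reflect_upd_other k c x i z : i <> k -> reflect k c (upd x i z) = upd (reflect k c x) i z.
Proof. intros N; unfold reflect; rewrite nth_upd_other, upd_comm; auto. Qed.

(** The sites [x + m z u_k] are pairwise distinct because [z] is nonzero, so the left side is a
    partial sum of the squared norm. *)
Lemma orbit_bound d f x k z K : (k < d)%nat -> valid d x -> z <> 0%Z -> square_summable d f ->
  sumR K (fun m => f (upd x k (z * Z.of_nat m)) * f (upd x k (z * Z.of_nat m))) <= ip d f f.
Proof.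
  intros Hk Hx Hz Hf.
  set (p := fun m => upd x k (z * Z.of_nat m)).
  (* The list is reversed so that its head is the last term added by [sumR]. *)
  replace (sumR K _) with (sumL (fun y => f y * f y) (map p (rev (seq 0 K)))).
  - apply ip_ge_list; [assumption|split].
    + apply Injective_map_NoDup; [|apply NoDup_rev, seq_NoDup].
      intros m m' E; apply (f_equal (fun y => nth k y 0%Z)) in E; unfold p, valid in *.
      rewrite !nth_upd_same in E by lia. nia.
    + apply Forall_map, Forall_forall; intros; now apply valid_upd.
  - induction K as [|K IH]; [reflexivity|].
    rewrite seq_S, rev_app_distr; simpl; rewrite IH; unfold p; simpl; ring.
Qed.

(** Along the infinite orbit of [x] under the translation the values become equal, which a bound in
    [l2] allows only if they tend to 0. *)
Lemma null_of_shift_invariance d u x k z : (k < d)%nat -> valid d x -> z <> 0%Z ->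
  bounded_seq d u ->
  (forall y, valid d y -> null (fun n => u n (upd y k z) - u n y)) -> null (fun n => u n x).
Proof.
  intros Hk Hx Hz [C HC] T.
  apply null_ext with (fun n => u n (upd x k (z * Z.of_nat 0))).
  { intros; rewrite Z.mul_0_r, upd_zero; reflexivity. }
  apply (null_of_translates (fun n m => u n (upd x k (z * Z.of_nat m))) C).
  - intros n K; destruct (HC n) as [Hu Bu]; eapply Rle_trans; [|exact Bu].
    now apply orbit_bound.
  - intros m; eapply null_ext; [|apply (T (upd x k (z * Z.of_nat m))); now apply valid_upd].
    intros n; simpl; rewrite upd_upd; do 3 f_equal; lia.
Qed.

(** * The Morawetz estimate *)

Definition sh (k : nat) (z : Z) (f : field) : field := pull f (fun x => upd x k z).
Definition neighbours (i : nat) (f : field) : field := lin 1 (sh i 1 f) 1 (sh i (-1) f).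
Definition side (k : nat) (c : Z) : field := fun x => IZR (Z.sgn (nth k x 0%Z - c)).
(** The Morawetz multiplier: a central difference in direction [k], oriented away from the
    hyperplane [x_k = c]. *)
Definition gradient (k : nat) (c : Z) (f : field) : field :=
  mul (side k c) (lin 1 (sh k 1 f) (-1) (sh k (-1) f)).
Definition vanishes_on (d k : nat) (c : Z) (f : field) : Prop :=
  forall x, valid d x -> nth k x 0%Z = c -> f x = 0.

Lemma square_summable_sh d k z f : square_summable d f -> square_summable d (sh k z f).
Proof. eapply square_summable_pull, bijective_upd. Qed.

Lemma side_range k c x : -1 <= side k c x <= 1.
Proof. unfold side; destruct (nth k x 0%Z - c)%Z; simpl; lra. Qed.

Local Hint Resolve square_summable_sh square_summable_lin square_summable_mul side_range : l2.

Lemma square_summable_neighbours d i f : square_summable d f -> square_summable d (neighbours i f).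
Proof. unfold neighbours; auto with l2. Qed.

Lemma square_summable_gradient d k c f : square_summable d f -> square_summable d (gradient k c f).
Proof. unfold gradient; auto with l2. Qed.

Local Hint Resolve square_summable_neighbours square_summable_gradient : l2.

Lemma ip_sh d k z f g : square_summable d f -> square_summable d g ->
  ip d (sh k z f) g = ip d f (sh k (- z) g).
Proof.
  intros Hf Hg; rewrite <- (ip_pull d (sh k z f) g _ _ (bijective_upd d k (- z))) by auto with l2.
  apply ip_ext; [|reflexivity].
  intros x _; unfold sh, pull; rewrite upd_upd, Z.add_opp_diag_l, upd_zero; reflexivity.
Qed.

Lemma ip_neighbours d i f g : square_summable d f -> square_summable d g ->
  ip d (neighbours i f) g = ip d f (neighbours i g).
Proof.
  intros; unfold neighbours; rewrite ip_linl, ip_linr, !ip_sh by auto with l2.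
  simpl; ring.
Qed.

(** Summation by parts: the central difference is antisymmetric, the sign is a symmetric multiplier,
    and the boundary terms at the hyperplane vanish. *)
Lemma gradient_antisym d k c f g : (k < d)%nat ->
  square_summable d f -> square_summable d g ->
  vanishes_on d k c f -> vanishes_on d k c g ->
  ip d (gradient k c f) g = - ip d f (gradient k c g).
Proof.
  intros Hk Hf Hg Vf Vg.
  transitivity (ip d (lin 1 (sh k 1 f) (-1) (sh k (-1) f)) (mul (side k c) g)).
  { apply tsum_ext; intros x _; unfold gradient, mul; ring. }
  rewrite ip_linl, !ip_sh by auto with l2.
  (* The weight commutes with the unit translations up to its jump at the hyperplane, where f and g vanish. *)
  assert (E : forall z, (z = 1 \/ z = -1)%Z ->
    ip d f (sh k z (mul (side k c) g)) = ip d f (mul (side k c) (sh k z g))).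
  { intros z Hz; apply tsum_ext; intros x Hx.
    unfold mul, sh, pull, side; unfold valid in Hx; rewrite nth_upd_same by lia.
    destruct (Z.eq_dec (nth k x 0%Z) c) as [e|n]; [rewrite (Vf x Hx e); ring|].
    destruct (Z.eq_dec (nth k x 0%Z + z) c) as [e|n'].
    - rewrite (Vg (upd x k z)); [ring|now apply valid_upd|].
      rewrite nth_upd_same; lia.
    (* Neither site lies on the hyperplane and a unit step cannot jump over it, so the two signs
       agree. *)
    - do 3 f_equal; lia. }
  rewrite !E by lia.
  transitivity (- ip d f (lin 1 (mul (side k c) (sh k 1 g)) (-1) (mul (side k c) (sh k (-1) g)))).
  - rewrite ip_linr by auto with l2; simpl; ring.
  - f_equal; apply tsum_ext; intros x _; unfold gradient, lin, mul; ring.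
Qed.

Lemma vanishes_neighbours d i k c f : i <> k -> vanishes_on d k c f ->
  vanishes_on d k c (neighbours i f).
Proof.
  intros N V x Hx E; unfold neighbours, lin, sh, pull.
  rewrite !V; auto using valid_upd; try ring; now rewrite nth_upd_other.
Qed.

Lemma gradient_neighbours_comm i k c f : i <> k ->
  gradient k c (neighbours i f) = neighbours i (gradient k c f).
Proof.
  intros N; apply functional_extensionality; intros x.
  unfold gradient, neighbours, mul, lin, sh, pull, side.
  rewrite !(nth_upd_other x i k), !(upd_comm x i k) by assumption; ring.
Qed.

(** For [i <> k] the symmetric operator [neighbours i] commutes with the antisymmetric
    [gradient k c]; their product is antisymmetric and its quadratic form is 0. *)
Lemma gradient_transversal d i k c f : (k < d)%nat -> i <> k ->
  square_summable d f -> vanishes_on d k c f ->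
  ip d (gradient k c f) (neighbours i f) = 0.
Proof.
  intros Hk N Hf V.
  assert (ip d (gradient k c f) (neighbours i f) = - ip d (gradient k c f) (neighbours i f)).
  { rewrite gradient_antisym at 1; auto using vanishes_neighbours with l2.
    rewrite gradient_neighbours_comm, <- ip_neighbours, ip_sym by auto with l2; reflexivity. }
  lra.
Qed.

(** This is the positive commutator. The integrand is the sign times a difference of two squares;
    translating both back to [f x * f x] leaves the weight [side (x - u_k) - side (x + u_k)], which
    is never positive and equals -1 at distance 1 beyond the hyperplane. *)
Lemma gradient_longitudinal d k c f y : (k < d)%nat -> valid d y -> nth k y 0%Z = (c + 1)%Z ->
  square_summable d f -> vanishes_on d k c f ->
  ip d (gradient k c f) (neighbours k f) <= - (f y * f y).
Proof.
  intros Hk Hy Ey Hf V.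
  transitivity (ip d (mul (side k c) (sh k 1 f)) (sh k 1 f)
    - ip d (mul (side k c) (sh k (-1) f)) (sh k (-1) f)); [right|].
  { transitivity (1 * ip d (mul (side k c) (sh k 1 f)) (sh k 1 f)
      + (-1) * ip d (mul (side k c) (sh k (-1) f)) (sh k (-1) f)); [|ring].
    unfold ip; rewrite <- tsum_lin by (apply summable_mul; auto with l2).
    apply tsum_ext; intros x _; unfold gradient, neighbours, mul, lin; ring. }
  (* Change variables so that the translation acts on the weight instead of the field. *)
  assert (E : forall z, ip d (mul (side k c) (sh k z f)) (sh k z f)
    = ip d (mul (sh k (- z) (side k c)) f) f).
  { intros z; rewrite <- (ip_pull d _ _ _ _ (bijective_upd d k (- z))) by auto with l2.
    apply tsum_ext; intros x _; unfold mul, sh, pull.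
    now rewrite upd_upd, Z.add_opp_diag_r, upd_zero || rewrite upd_upd, Z.add_opp_diag_l, upd_zero. }
  rewrite !E; change (- (1))%Z with (-1)%Z; change (- (-1))%Z with 1%Z.
  assert (Q : forall z x, -1 <= sh k z (side k c) x <= 1) by (intros; apply side_range).
  set (w := fun x => 1 * (mul (sh k 1 (side k c)) f x * f x)
                   + (-1) * (mul (sh k (-1) (side k c)) f x * f x)).
  assert (W : tsum d w = ip d (mul (sh k 1 (side k c)) f) f - ip d (mul (sh k (-1) (side k c)) f) f).
  { unfold w; rewrite tsum_lin by (apply summable_mul; auto with l2); unfold ip; ring. }
  assert (T : sumL w [y] <= tsum d w).
  { apply tsum_nonneg_ge.
    - intros x Hx; unfold w, mul, sh, pull, side; unfold valid in Hx.
      rewrite !nth_upd_same by lia.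
      assert (M : IZR (Z.sgn (nth k x 0%Z + -1 - c)) <= IZR (Z.sgn (nth k x 0%Z + 1 - c)))
        by (apply IZR_le; lia).
      assert (0 <= f x * f x) by nra. nra.
    - unfold w; apply summable_lin; apply summable_mul; auto with l2.
    - repeat constructor; [simpl; tauto|assumption]. }
  simpl in T; unfold w at 1, mul, sh, pull, side in T; unfold valid in Hy.
  rewrite !nth_upd_same, Ey in T by lia.
  (* At [y] the two shifted signs are those of 2 and 0, hence 1 and 0. *)
  replace (c + 1 + 1 - c)%Z with 2%Z in T by lia.
  replace (c + 1 + -1 - c)%Z with 0%Z in T by lia.
  simpl in T; lra.
Qed.

Lemma bounded_ip d u v : bounded_seq d u -> bounded_seq d v ->
  exists C, forall n, Rabs (ip d (u n) (v n)) <= C.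
Proof.
  intros [C HC] [C' HC']; exists (C + C'); intros n.
  destruct (HC n) as [Hu Bu], (HC' n) as [Hv Bv].
  pose proof (ip_abs_le d _ _ Hu Hv). pose proof (Rabs_pos (ip d (u n) (v n))). lra.
Qed.

Lemma bounded_sumR N (h : nat -> nat -> R) :
  (forall i, (i < N)%nat -> exists C, forall n, Rabs (h i n) <= C) ->
  exists C, forall n, Rabs (sumR N (fun i => h i n)) <= C.
Proof.
  induction N as [|N IH]; intros H.
  - exists 0; intros; simpl; rewrite Rabs_R0; lra.
  - destruct IH as [C HC]; [auto|]. destruct (H N) as [C' HC']; [lia|].
    exists (C + C'); intros n; simpl; eapply Rle_trans; [apply Rabs_triang|].
    specialize (HC n); specialize (HC' n); lra.
Qed.

Lemma bounded_gradient d k c u : bounded_seq d u -> bounded_seq d (fun n => gradient k c (u n)).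
Proof.
  intros H; unfold gradient; apply bounded_mul; [apply side_range|].
  apply bounded_lin; eapply bounded_pull; eauto using bijective_upd.
Qed.

(* Discrete Morawetz estimate: the momentum <gradient G(n), G(n+1)> is bounded, and its
   increments control the square of the k-th field next to the hyperplane; the common
   forcing K drops out because of the linear constraint. *)
Lemma morawetz_decay d k c (G0 : nat -> field) (G : nat -> nat -> field) (K : nat -> field) y :
  (k < d)%nat -> valid d y -> nth k y 0%Z = (c + 1)%Z ->
  bounded_seq d G0 -> (forall i, (i < d)%nat -> bounded_seq d (G i)) ->
  (forall n, square_summable d (K n)) ->
  (forall n, vanishes_on d k c (G0 n)) -> (forall i n, vanishes_on d k c (G i n)) ->
  (forall n, vanishes_on d k c (K n)) ->
  (forall n x, valid d x -> G0 (n + 2)%nat x + G0 n x = -2 * G0 (n + 1)%nat x + K n x) ->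
  (forall i n x, (i < d)%nat -> valid d x ->
     G i (n + 2)%nat x + G i n x = - neighbours i (G i (n + 1)%nat) x + K n x) ->
  (forall n x, valid d x -> G0 n x + 2 * sumR d (fun i => G i n x) = 0) ->
  null (fun n => G k n y).
Proof.
  intros Hk Hy Ey B0 BG SK V0 VG VK E0 EG EC.
  assert (S0 : forall n, square_summable d (G0 n)) by (intros n; exact (bounded_square_summable d G0 n B0)).
  assert (SG : forall i n, (i < d)%nat -> square_summable d (G i n))
    by (intros i n Hi; exact (bounded_square_summable d (G i) n (BG i Hi))).
  set (p := fun (H : nat -> field) n => ip d (gradient k c (H n)) (H (n + 1)%nat)).
  (* Antisymmetry moves the gradient onto time [n + 1] in both momenta, which produces the sum
     [H (n + 2) + H n] of the wave equations. *)
  assert (inc : forall H n, (forall n, square_summable d (H n)) -> (forall n, vanishes_on d k c (H n)) ->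
    p H (n + 1)%nat - p H n = ip d (gradient k c (H (n + 1)%nat)) (lin 1 (H (n + 2)%nat) 1 (H n))).
  { intros H n SH VH; unfold p.
    rewrite (gradient_antisym d k c (H n)), ip_linr, (ip_sym d (H n)) by auto with l2.
    replace (n + 1 + 1)%nat with (n + 2)%nat by lia; ring. }
  assert (I0 : forall n, p G0 (n + 1)%nat - p G0 n = - ip d (G0 (n + 1)%nat) (gradient k c (K n))).
  { intros n; rewrite inc by auto.
    rewrite (ip_ext d _ (gradient k c (G0 (n + 1)%nat)) _ (lin (-2) (G0 (n + 1)%nat) 1 (K n)));
      [|reflexivity|intros x Hx; unfold lin; pose proof (E0 n x Hx); lra].
    rewrite ip_linr, (gradient_antisym d k c _ (K n)) by auto with l2.
    (* The term [-2 G0 (n + 1)] of the equation contributes nothing, again by antisymmetry. *)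
    assert (ip d (gradient k c (G0 (n + 1)%nat)) (G0 (n + 1)%nat) = 0); [|lra].
    pose proof (gradient_antisym d k c (G0 (n + 1)%nat) (G0 (n + 1)%nat) Hk
      (S0 _) (S0 _) (V0 _) (V0 _)) as A.
    rewrite (ip_sym d (G0 (n + 1)%nat)) in A; lra. }
  assert (IG : forall i n, (i < d)%nat -> p (G i) (n + 1)%nat - p (G i) n =
    - ip d (gradient k c (G i (n + 1)%nat)) (neighbours i (G i (n + 1)%nat))
    - ip d (G i (n + 1)%nat) (gradient k c (K n))).
  { intros i n Hi; rewrite inc by auto.
    rewrite (ip_ext d _ (gradient k c (G i (n + 1)%nat)) _
      (lin (-1) (neighbours i (G i (n + 1)%nat)) 1 (K n)));
      [|reflexivity|intros x Hx; unfold lin; pose proof (EG i n x Hi Hx); lra].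
    rewrite ip_linr, (gradient_antisym d k c _ (K n)) by auto with l2. ring. }
  (* The weights 1 and 2 are those of the linear constraint, so that the forcing cancels in the
     total. *)
  set (M := fun n => p G0 n + 2 * sumR d (fun i => p (G i) n)).
  assert (BM : exists C, forall n, Rabs (M n) <= C).
  { destruct (bounded_ip d (fun n => gradient k c (G0 n)) (fun n => G0 (n + 1)%nat)) as [C HC];
      [now apply bounded_gradient|now apply bounded_shift|].
    destruct (bounded_sumR d (fun i n => p (G i) n)) as [C' HC'].
    { intros i Hi; apply (bounded_ip d (fun n => gradient k c (G i n)) (fun n => G i (n + 1)%nat));
      [apply bounded_gradient|apply bounded_shift]; auto. }
    exists (C + 2 * C'); intros n; unfold M.
    eapply Rle_trans; [apply Rabs_triang|]; rewrite Rabs_mult, (Rabs_right 2) by lra.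
    specialize (HC n); specialize (HC' n); fold (p G0 n) in HC; simpl in HC'; lra. }
  destruct BM as [C HC].
  (* The increment of [M] from [n] to [n + 1] controls the field at time [n + 1], hence the shift of
     the sequence. *)
  apply null_unshift, null_of_increments with M C; [assumption|]; intros n.
  set (X := gradient k c (K n)).
  assert (SX : square_summable d X) by (unfold X; auto with l2).
  (* The forcing terms add up to the pairing of the constraint with [X]. *)
  assert (Z : ip d (G0 (n + 1)%nat) X + 2 * sumR d (fun i => ip d (G i (n + 1)%nat) X) = 0).
  { rewrite <- ip_fsuml by auto.
    transitivity (ip d (lin 1 (G0 (n + 1)%nat) 2 (fsum d (fun i => G i (n + 1)%nat))) X).
    - rewrite ip_linl; auto using square_summable_fsum; ring.
    - rewrite <- (ip_zero_l d X); apply ip_ext; [|reflexivity].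
      intros x Hx; unfold lin, fsum; rewrite Rmult_1_l; now apply EC. }
  set (q := fun i => - ip d (gradient k c (G i (n + 1)%nat)) (neighbours i (G i (n + 1)%nat))).
  assert (MM : M (n + 1)%nat - M n = 2 * sumR d q).
  { unfold M.
    assert (SS : sumR d (fun i => p (G i) (n + 1)%nat)
      = 1 * sumR d (fun i => p (G i) n)
        + 1 * (1 * sumR d q + (-1) * sumR d (fun i => ip d (G i (n + 1)%nat) X))).
    { rewrite <- !sumR_lin; apply sumR_ext; intros i Hi.
      unfold q; pose proof (IG i n Hi) as J; fold X in J; lra. }
    rewrite SS; specialize (I0 n); fold X in I0; lra. }
  assert (QK : G k (n + 1)%nat y * G k (n + 1)%nat y <= q k).
  { unfold q; pose proof (gradient_longitudinal d k c (G k (n + 1)%nat) y Hk Hy Ey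
      (SG k _ Hk) (VG k _)); lra. }
  assert (q k <= sumR d q).
  { apply sumR_ge_term; [|assumption]; intros i Hi.
    destruct (Nat.eq_dec i k) as [->|N]; [nra|].
    unfold q; rewrite gradient_transversal; auto; lra. }
  nra.
Qed.

(** * The walk on real states *)

Definition rstate := list Z -> nat -> R.
Definition coord (a : rstate) (j : nat) : field := fun x => a x j.
Definition rwalk (d : nat) (a : rstate) : rstate := fun x j =>
  2 / INR (Dim d) * sumR (Dim d) (a (Defs.pre d x j)) - a (Defs.pre d x j) j.
Definition slin (s : R) (a : rstate) (t : R) (b : rstate) : rstate :=
  fun x j => s * a x j + t * b x j.
Definition sq_state (d : nat) (a : rstate) : Prop :=
  forall j, (j < Dim d)%nat -> square_summable d (coord a j).
Definition dot (d : nat) (a b : rstate) : R :=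
  sumR (Dim d) (fun j => ip d (coord a j) (coord b j)).
Definition riter (d n : nat) (a : rstate) : rstate := Nat.iter n (rwalk d) a.

Lemma Dim_pos d : 0 < INR (Dim d).
Proof. apply lt_0_INR; unfold Dim; lia. Qed.

Lemma pre_forward d x i : (i < d)%nat -> Defs.pre d x i = upd x i (-1).
Proof. intros H; unfold Defs.pre; apply Nat.ltb_lt in H; now rewrite H. Qed.

Lemma pre_rest d x : Defs.pre d x d = x.
Proof. unfold Defs.pre; now rewrite Nat.ltb_irrefl, Nat.eqb_refl. Qed.

Lemma pre_backward d x i : Defs.pre d x (d + 1 + i) = upd x i 1.
Proof.
  unfold Defs.pre; destruct (Nat.ltb_spec (d + 1 + i) d); [lia|].
  destruct (Nat.eqb_spec (d + 1 + i) d); [lia|]; f_equal; lia.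
Qed.

Lemma Dim_cases d j : (j < Dim d)%nat ->
  (j < d)%nat \/ j = d \/ exists i, (i < d)%nat /\ j = (d + 1 + i)%nat.
Proof.
  unfold Dim; intros H.
  destruct (lt_eq_lt_dec j d) as [[|]|]; auto.
  right; right; exists (j - d - 1)%nat; lia.
Qed.

Lemma bijective_pre d j : exists psi, bijective_on d (fun x => Defs.pre d x j) psi.
Proof.
  unfold Defs.pre; destruct (Nat.ltb j d); [|destruct (Nat.eqb j d)].
  - eexists; apply bijective_upd.
  - exists (fun x => x); repeat split; auto.
  - eexists; apply bijective_upd.
Qed.

Lemma valid_pre d x j : valid d x -> valid d (Defs.pre d x j).
Proof. destruct (bijective_pre d j) as [psi [V _]]; apply V. Qed.

Lemma coord_rwalk d a j : coord (rwalk d a) j =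
  pull (lin (2 / INR (Dim d)) (fsum (Dim d) (coord a)) (-1) (coord a j)) (fun x => Defs.pre d x j).
Proof.
  apply functional_extensionality; intros x.
  transitivity (2 / INR (Dim d) * sumR (Dim d) (a (Defs.pre d x j)) + -1 * a (Defs.pre d x j) j);
    [unfold coord, rwalk; ring|reflexivity].
Qed.

Lemma sq_state_rwalk d a : sq_state d a -> sq_state d (rwalk d a).
Proof.
  intros H j Hj; rewrite coord_rwalk; destruct (bijective_pre d j) as [psi Hb].
  eapply square_summable_pull; [exact Hb|].
  apply square_summable_lin; auto using square_summable_fsum.
Qed.

Lemma sq_state_slin d s a t b : sq_state d a -> sq_state d b -> sq_state d (slin s a t b).
Proof. intros Ha Hb j Hj; apply (square_summable_lin d s (coord a j) t (coord b j)); auto. Qed.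

(** Each component is transported by a bijection of the lattice, so what remains is the
    orthogonality of the Grover matrix: with [c = 2 / D], the terms in [<A, B>] cancel because
    [c^2 D = 2 c]. *)
Lemma dot_rwalk d a b : sq_state d a -> sq_state d b ->
  dot d (rwalk d a) (rwalk d b) = dot d a b.
Proof.
  intros Ha Hb; unfold dot.
  set (A := fsum (Dim d) (coord a)); set (B := fsum (Dim d) (coord b)).
  assert (SA : square_summable d A) by now apply square_summable_fsum.
  assert (SB : square_summable d B) by now apply square_summable_fsum.
  set (c := 2 / INR (Dim d)).
  transitivity (sumR (Dim d) (fun j => 1 * (1 * (c * c * ip d A B) + (-c) * ip d (coord b j) A)
    + 1 * ((-c) * ip d (coord a j) B + 1 * ip d (coord a j) (coord b j)))).
  - apply sumR_ext; intros j Hj; rewrite !coord_rwalk; destruct (bijective_pre d j) as [psi Hp].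
    fold A B c; rewrite (ip_pull d _ _ _ psi) by auto using square_summable_lin.
    rewrite ip_linl, !ip_linr, (ip_sym d A (coord b j)) by auto using square_summable_lin; ring.
  - rewrite !sumR_lin, sumR_const, <- !ip_fsuml by auto.
    fold A B; rewrite (ip_sym d B A); unfold c; field.
    pose proof (Dim_pos d); lra.
Qed.

Lemma rwalk_slin d s a t b : rwalk d (slin s a t b) = slin s (rwalk d a) t (rwalk d b).
Proof.
  apply functional_extensionality; intros x; apply functional_extensionality; intros j.
  unfold rwalk, slin; rewrite sumR_lin; ring.
Qed.

Lemma riter_slin d n s a t b : riter d n (slin s a t b) = slin s (riter d n a) t (riter d n b).
Proof.
  induction n as [|n IH]; [reflexivity|]; unfold riter in *; simpl.
  now rewrite IH, rwalk_slin.
Qed.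

Lemma riter_succ d n a : riter d (n + 1) a = rwalk d (riter d n a).
Proof. now rewrite Nat.add_1_r. Qed.

Lemma riter_succ_r d n a : riter d (n + 1) a = riter d n (rwalk d a).
Proof.
  induction n as [|n IH]; [reflexivity|].
  change (rwalk d (riter d (n + 1) a) = rwalk d (riter d n (rwalk d a))); now rewrite IH.
Qed.

Lemma sq_state_riter d n a : sq_state d a -> sq_state d (riter d n a).
Proof. intros; induction n; [assumption|]; now apply sq_state_rwalk. Qed.

Lemma dot_riter d n a : sq_state d a -> dot d (riter d n a) (riter d n a) = dot d a a.
Proof.
  intros H; induction n as [|n IH]; [reflexivity|].
  rewrite <- IH; apply dot_rwalk; now apply sq_state_riter.
Qed.

Lemma dot_ge_coord d a j : sq_state d a -> (j < Dim d)%nat -> ip d (coord a j) (coord a j) <= dot d a a.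
Proof.
  intros H Hj; apply (sumR_ge_term _ (fun j => ip d (coord a j) (coord a j))); [|assumption].
  intros i Hi; apply ip_ge0; auto.
Qed.

Lemma bounded_riter d a j : sq_state d a -> (j < Dim d)%nat ->
  bounded_seq d (fun n => coord (riter d n a) j).
Proof.
  intros H Hj; exists (dot d a a); intros n; split; [now apply sq_state_riter|].
  rewrite <- (dot_riter d n a H); apply dot_ge_coord; auto using sq_state_riter.
Qed.

Lemma sumR_Dim d h : sumR (Dim d) h = sumR d h + h d + sumR d (fun i => h (d + 1 + i)%nat).
Proof.
  unfold Dim; replace (2 * d + 1)%nat with (d + 1 + d)%nat by lia.
  assert (A : forall m n, sumR (m + n) h = sumR m h + sumR n (fun i => h (m + i)%nat)).
  { intros m n; induction n; [rewrite Nat.add_0_r; simpl; lra|].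
    rewrite Nat.add_succ_r; simpl; rewrite IHn; lra. }
  rewrite !A; simpl; rewrite Nat.add_0_r; ring.
Qed.

(** * Deviations from the mean and their wave equations *)

Definition mean (d : nat) (a : rstate) : field :=
  mul (fun _ => / INR (Dim d)) (fsum (Dim d) (coord a)).
Definition rest_dev (d : nat) (a : rstate) : field := lin 1 (coord a d) (-1) (mean d a).
Definition pair_dev (d i : nat) (a : rstate) : field :=
  lin 1 (lin (1/2) (coord a i) (1/2) (coord a (d + 1 + i))) (-1) (mean d a).

Lemma rwalk_forward d a x i : (i < d)%nat ->
  rwalk d a x i = 2 * mean d a (upd x i (-1)) - a (upd x i (-1)) i.
Proof.
  intros H; unfold rwalk, mean, mul, fsum, coord; rewrite pre_forward by assumption.
  unfold Rdiv; rewrite (Rmult_assoc 2); reflexivity.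
Qed.

Lemma rwalk_rest d a x : rwalk d a x d = 2 * mean d a x - a x d.
Proof.
  unfold rwalk, mean, mul, fsum, coord; rewrite pre_rest; unfold Rdiv; rewrite (Rmult_assoc 2); reflexivity.
Qed.

Lemma rwalk_backward d a x i :
  rwalk d a x (d + 1 + i)%nat = 2 * mean d a (upd x i 1) - a (upd x i 1) (d + 1 + i)%nat.
Proof.
  unfold rwalk, mean, mul, fsum, coord; rewrite pre_backward.
  unfold Rdiv; rewrite (Rmult_assoc 2); reflexivity.
Qed.

(** Add the relation [a_0(n+1) + a_0(n) = 2 m(n)] at two consecutive times. *)
Lemma rest_dev_wave d a x :
  rest_dev d (rwalk d (rwalk d a)) x + rest_dev d a x =
  -2 * rest_dev d (rwalk d a) x + (mean d a x - mean d (rwalk d (rwalk d a)) x).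
Proof.
  unfold rest_dev, lin, coord; rewrite (rwalk_rest d (rwalk d a)), (rwalk_rest d a); ring.
Qed.

(** Component [i] at [x] at time [n + 2] comes from [x - u_i] at time [n + 1], and component [i] at
    [x] at time [n] goes to [x + u_i]; together they give the neighbours at time [n + 1]. Averaging
    with the opposite direction makes the contribution of the mean symmetric, so that subtracting
    [m] leaves a forcing that does not depend on [i]. *)
Lemma pair_dev_wave d i a x : (i < d)%nat ->
  pair_dev d i (rwalk d (rwalk d a)) x + pair_dev d i a x =
  - neighbours i (pair_dev d i (rwalk d a)) x + (mean d a x - mean d (rwalk d (rwalk d a)) x).
Proof.
  intros Hi; unfold neighbours, sh, pull; unfold pair_dev, lin, coord.
  rewrite (rwalk_forward d (rwalk d a) x i), (rwalk_backward d (rwalk d a) x i) by assumption.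
  rewrite (rwalk_forward d a (upd x i 1) i), (rwalk_backward d a (upd x i (-1)) i) by assumption.
  rewrite !upd_upd; change (1 + -1)%Z with 0%Z; change (-1 + 1)%Z with 0%Z; rewrite !upd_zero.
  field.
Qed.

(** Deviations from a mean add up to 0; the factor 2 undoes the half in [pair_dev]. *)
Lemma dev_constraint d a x : rest_dev d a x + 2 * sumR d (fun i => pair_dev d i a x) = 0.
Proof.
  unfold rest_dev, pair_dev, lin.
  rewrite sumR_lin, sumR_lin, sumR_const.
  assert (E : sumR d (fun i => coord a i x) + coord a d x + sumR d (fun i => coord a (d + 1 + i) x)
     = INR (Dim d) * mean d a x).
  { rewrite <- (sumR_Dim d (fun i => coord a i x)); unfold mean, mul, fsum; field.
    pose proof (Dim_pos d); lra. }
  unfold Dim in E at 1; rewrite plus_INR, mult_INR in E; simpl INR in E; lra.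
Qed.

(** Normalised without the usual factor 1/2. The wave equations and the constraint are linear and
    invariant under the reflection, so odd parts inherit them, and they vanish on the hyperplane as
    the Morawetz estimate requires. *)
Definition odd_part (k : nat) (c : Z) (f : field) : field := lin 1 f (-1) (pull f (reflect k c)).

Lemma odd_part_vanishes d k c f : vanishes_on d k c (odd_part k c f).
Proof.
  intros x _ E; unfold odd_part, lin, pull, reflect.
  rewrite E, Z.sub_diag, Z.mul_0_r, upd_zero; ring.
Qed.

Lemma bounded_odd_part d k c u : bounded_seq d u -> bounded_seq d (fun n => odd_part k c (u n)).
Proof.
  intros; apply bounded_lin; [assumption|]; eapply bounded_pull; eauto using bijective_reflect.
Qed.

(** In direction [k] the reflection exchanges the two unit translations, and [neighbours] is their
    sum. *)
Lemma odd_part_neighbours d k c i f x : (k < d)%nat -> valid d x ->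
  odd_part k c (neighbours i f) x = neighbours i (odd_part k c f) x.
Proof.
  intros Hk Hx; unfold odd_part, neighbours, lin, sh, pull.
  destruct (Nat.eq_dec i k) as [->|N].
  - rewrite !(reflect_upd_same d) by assumption; simpl; ring.
  - rewrite !reflect_upd_other by assumption; ring.
Qed.

Section Trajectory.
Context (d : nat) (a : rstate) (Ha : sq_state d a).

Lemma bounded_mean : bounded_seq d (fun n => mean d (riter d n a)).
Proof.
  apply bounded_mul.
  - intros _; pose proof (Dim_pos d) as P; pose proof (Rinv_0_lt_compat _ P).
    assert (1 <= INR (Dim d)) by (apply (le_INR 1); unfold Dim; lia).
    assert (/ INR (Dim d) <= / 1) by (apply Rinv_le_contravar; lra). lra.
  - apply (bounded_fsum d (Dim d) (fun j n => coord (riter d n a) j)); intros; now apply bounded_riter.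
Qed.

Lemma bounded_rest_dev : bounded_seq d (fun n => rest_dev d (riter d n a)).
Proof. apply bounded_lin; [apply bounded_riter; auto; unfold Dim; lia|apply bounded_mean]. Qed.

Lemma bounded_pair_dev i : (i < d)%nat -> bounded_seq d (fun n => pair_dev d i (riter d n a)).
Proof.
  intros Hi; apply bounded_lin; [|apply bounded_mean].
  apply bounded_lin; apply bounded_riter; auto; unfold Dim; lia.
Qed.

Lemma pair_dev_odd_decay k c y : (k < d)%nat -> valid d y -> nth k y 0%Z = (c + 1)%Z ->
  null (fun n => odd_part k c (pair_dev d k (riter d n a)) y).
Proof.
  intros Hk Hy Ey.
  assert (R2 : forall n, riter d (n + 2) a = rwalk d (rwalk d (riter d n a))).
  { intros n; now replace (n + 2)%nat with (S (S n)) by lia. }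
  apply (morawetz_decay d k c (fun n => odd_part k c (rest_dev d (riter d n a)))
    (fun i n => odd_part k c (pair_dev d i (riter d n a)))
    (fun n => odd_part k c (lin 1 (mean d (riter d n a)) (-1) (mean d (riter d (n + 2) a)))));
    try assumption; intros; try apply odd_part_vanishes.
  - apply bounded_odd_part, bounded_rest_dev.
  - now apply bounded_odd_part, bounded_pair_dev.
  - apply square_summable_lin.
    + apply square_summable_lin; apply (bounded_square_summable d _ _ bounded_mean).
    + eapply square_summable_pull; [apply bijective_reflect|].
      apply square_summable_lin; apply (bounded_square_summable d _ _ bounded_mean).
  - rewrite R2, riter_succ; unfold odd_part, lin, pull.
    pose proof (rest_dev_wave d (riter d n a) x).
    pose proof (rest_dev_wave d (riter d n a) (reflect k c x)). lra.
  - rewrite <- (odd_part_neighbours d) by assumption.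
    rewrite R2, riter_succ; unfold odd_part, lin, pull.
    pose proof (pair_dev_wave d i (riter d n a) x H).
    pose proof (pair_dev_wave d i (riter d n a) (reflect k c x) H). lra.
  - unfold odd_part, lin, pull; rewrite sumR_lin.
    pose proof (dev_constraint d (riter d n a) x).
    pose proof (dev_constraint d (riter d n a) (reflect k c x)). lra.
Qed.

Lemma pair_dev_decay i x : (i < d)%nat -> valid d x -> null (fun n => pair_dev d i (riter d n a) x).
Proof.
  intros Hi Hx.
  apply (null_of_shift_invariance d (fun n => pair_dev d i (riter d n a)) x i (-2)); auto.
  - lia.
  - now apply bounded_pair_dev.
  - intros y Hy.
    (* Reflecting [y] in the hyperplane through [y - u_i] gives [y - 2 u_i], so the decay of the odd
       part is asymptotic invariance under this translation. *)
    pose proof (pair_dev_odd_decay i (nth i y 0 - 1)%Z y Hi Hy ltac:(lia)) as N.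
    eapply null_ext; [|apply (null_lin (-1) _ 0 _ N N)].
    intros n; unfold odd_part, lin, pull, reflect.
    replace (2 * (nth i y 0 - 1 - nth i y 0))%Z with (-2)%Z by lia; ring.
Qed.

Lemma rest_dev_decay x : valid d x -> null (fun n => rest_dev d (riter d n a) x).
Proof.
  intros Hx; apply null_ext with
    (fun n => (-2) * sumR d (fun i => pair_dev d i (riter d n a) x) + 0 * 0).
  - intros n; pose proof (dev_constraint d (riter d n a) x); lra.
  - apply null_lin; [|apply null_zero].
    apply (null_sumR d (fun i n => pair_dev d i (riter d n a) x)); intros; now apply pair_dev_decay.
Qed.

End Trajectory.

(** * Asymptotic stationarity *)

Lemma increment_rest d a x : rwalk d a x d - a x d = -2 * rest_dev d a x.
Proof. rewrite rwalk_rest; unfold rest_dev, lin, coord; ring. Qed.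

(** Here laziness enters: the rest component obeys [a_0(n+1) + a_0(n) = 2 m(n)] at a fixed site, so
    the mean can move only by rest deviations. *)
Lemma increment_mean d a x :
  mean d (rwalk d a) x - mean d a x = - rest_dev d (rwalk d a) x - rest_dev d a x.
Proof. unfold rest_dev, lin, coord; rewrite rwalk_rest; ring. Qed.

Lemma increment_pair d i a x :
  (rwalk d a x i - a x i) + (rwalk d a x (d + 1 + i)%nat - a x (d + 1 + i)%nat) =
  2 * pair_dev d i (rwalk d a) x - 2 * pair_dev d i a x
  - 2 * rest_dev d (rwalk d a) x - 2 * rest_dev d a x.
Proof.
  pose proof (increment_mean d a x); unfold pair_dev, lin, coord; lra.
Qed.

(* Advancing two steps brings the pair (i, -i) back to where it was, so the increment both changes
   sign and moves by one site; hence it is asymptotically translation invariant. *)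
Lemma increment_translate d i a x : (i < d)%nat ->
  (rwalk d a (upd x i (-1)) i - a (upd x i (-1)) i) - (rwalk d a x i - a x i) =
  -2 * rest_dev d a (upd x i (-1)) - 2 * rest_dev d (rwalk d a) (upd x i (-1))
  + 2 * pair_dev d i (rwalk d a) (upd x i (-1)) + 2 * pair_dev d i a x.
Proof.
  intros Hi; set (y := upd x i (-1)).
  pose proof (increment_mean d a y) as M.
  pose proof (rwalk_forward d (rwalk d a) x i Hi) as E2.
  pose proof (rwalk_forward d a x i Hi) as E1.
  pose proof (rwalk_backward d a y i) as E3.
  assert (Ex : upd y i 1 = x) by (unfold y; rewrite upd_upd; apply upd_zero).
  fold y in E1, E2; rewrite Ex in E3.
  unfold pair_dev, lin, coord; lra.
Qed.

(** Forward increments are bounded in [l2] and, by [increment_translate], asymptotically translation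
    invariant, hence null. The rest increment is a multiple of a deviation, and a backward increment
    is the null sum over the pair minus the forward one. *)
Lemma increment_decay d a x j : sq_state d a -> valid d x -> (j < Dim d)%nat ->
  null (fun n => riter d (n + 1) a x j - riter d n a x j).
Proof.
  intros Ha Hx Hj.
  assert (P : forall i y, (i < d)%nat -> valid d y -> null (fun n => pair_dev d i (riter d n a) y))
    by (intros; now apply pair_dev_decay).
  assert (Q : forall y, valid d y -> null (fun n => rest_dev d (riter d n a) y))
    by (intros; now apply rest_dev_decay).
  assert (F : forall i y, (i < d)%nat -> valid d y ->
    null (fun n => riter d (n + 1) a y i - riter d n a y i)).
  { intros i y Hi Hy.
    apply null_ext with (fun n => lin 1 (coord (riter d (n + 1) a) i) (-1) (coord (riter d n a) i) y).
    { intros n; unfold lin, coord; ring. }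
    apply (null_of_shift_invariance d
      (fun n => lin 1 (coord (riter d (n + 1) a) i) (-1) (coord (riter d n a) i)) y i (-1));
      auto; [lia| |].
    - apply bounded_lin; [apply (bounded_shift d (fun n => coord (riter d n a) i))|];
      apply bounded_riter; auto; unfold Dim; lia.
    - intros z Hz; assert (Hz' : valid d (upd z i (-1))) by now apply valid_upd.
      eapply null_ext; [|exact (null_lin 2 _ 2 _
        (null_lin (-1) _ (-1) _ (Q _ Hz') (null_shift _ (Q _ Hz')))
        (null_lin 1 _ 1 _ (null_shift _ (P i _ Hi Hz')) (P i _ Hi Hz)))].
      intros n; cbv beta; pose proof (increment_translate d i (riter d n a) z Hi) as T.
      rewrite riter_succ; unfold lin, coord in *; lra. }
  destruct (Dim_cases d j Hj) as [Hi|[->|[i [Hi ->]]]].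
  - now apply F.
  - eapply null_ext; [|exact (null_lin (-2) _ 0 _ (Q x Hx) null_zero)].
    intros n; cbv beta; rewrite riter_succ, increment_rest; ring.
  - eapply null_ext; [|exact (null_lin 1 _ (-1) _
      (null_lin 2 _ (-2) _
        (null_lin 1 _ (-1) _ (null_shift _ (P i x Hi Hx)) (P i x Hi Hx))
        (null_lin 1 _ 1 _ (null_shift _ (Q x Hx)) (Q x Hx))) (F i x Hi Hx))].
    intros n; cbv beta; rewrite riter_succ; pose proof (increment_pair d i (riter d n a) x); lra.
Qed.

(** * The projection onto fixed states and convergence of the iterates *)

Lemma dot_sym d a b : dot d a b = dot d b a.
Proof. apply sumR_ext; intros; apply ip_sym. Qed.

Lemma dot_slinl d s a t b c : sq_state d a -> sq_state d b -> sq_state d c ->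
  dot d (slin s a t b) c = s * dot d a c + t * dot d b c.
Proof.
  intros Ha Hb Hc; unfold dot; rewrite <- sumR_lin; apply sumR_ext; intros j Hj.
  apply (ip_linl d s (coord a j) t (coord b j)); auto.
Qed.

Lemma dot_slinr d s a t b c : sq_state d a -> sq_state d b -> sq_state d c ->
  dot d c (slin s a t b) = s * dot d c a + t * dot d c b.
Proof. intros; rewrite dot_sym, dot_slinl, !(dot_sym d c); auto. Qed.

Lemma dot_slin_sq d t a e : sq_state d a -> sq_state d e ->
  dot d (slin t a 1 e) (slin t a 1 e) = t * t * dot d a a + 2 * t * dot d a e + dot d e e.
Proof.
  intros; rewrite dot_slinl, !dot_slinr, (dot_sym d e a) by auto using sq_state_slin; ring.
Qed.

Definition agree (d : nat) (a b : rstate) : Prop :=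
  forall x j, valid d x -> (j < Dim d)%nat -> a x j = b x j.

Lemma dot_agree d a a' b b' : agree d a a' -> agree d b b' -> dot d a b = dot d a' b'.
Proof. intros E E'; apply sumR_ext; intros j Hj; apply ip_ext; intros; [apply E|apply E']; auto. Qed.

Lemma rwalk_agree d a b : agree d a b -> agree d (rwalk d a) (rwalk d b).
Proof.
  intros E x j Hx Hj; unfold rwalk; rewrite (E _ j) by auto using valid_pre.
  rewrite (sumR_ext _ _ (b (Defs.pre d x j))); auto using valid_pre.
Qed.

Lemma riter_fixed d g n : agree d (rwalk d g) g -> agree d (riter d n g) g.
Proof.
  intros H; induction n as [|n IH]; [intros x j _ _; reflexivity|].
  intros x j Hx Hj; rewrite <- (H x j) by assumption; now apply rwalk_agree.
Qed.

Lemma dot_ge_pt d a x j : sq_state d a -> valid d x -> (j < Dim d)%nat -> a x j * a x j <= dot d a a.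
Proof.
  intros Ha Hx Hj; eapply Rle_trans; [|exact (dot_ge_coord d a j Ha Hj)].
  apply (ip_ge_pt d (coord a j)); auto.
Qed.

Lemma dot_ge0 d a : sq_state d a -> 0 <= dot d a a.
Proof.
  intros Ha; assert (H : (0 < Dim d)%nat) by (unfold Dim; lia).
  eapply Rle_trans; [|exact (dot_ge_coord d a 0 Ha H)]; apply ip_ge0; auto.
Qed.

Lemma parallelogram d a b : sq_state d a -> sq_state d b ->
  dot d (slin 1 a (-1) b) (slin 1 a (-1) b) =
  2 * dot d a a + 2 * dot d b b - 4 * dot d (slin (1/2) a (1/2) b) (slin (1/2) a (1/2) b).
Proof.
  intros; rewrite !dot_slinl, !dot_slinr, (dot_sym d b a) by auto using sq_state_slin; field.
Qed.

Definition tol (k : nat) : R := / (INR k + 1).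

Lemma tol_pos k : 0 < tol k.
Proof. apply Rinv_0_lt_compat; pose proof (pos_INR k); lra. Qed.

Lemma tol_small eps : 0 < eps -> exists N, forall k, (N <= k)%nat -> tol k < eps.
Proof.
  intros He; destruct (INR_unbounded (/ eps)) as [N HN]; exists N; intros k Hk.
  apply le_INR in Hk; unfold tol; pose proof (Rinv_0_lt_compat _ He).
  rewrite <- (Rinv_inv eps); apply Rinv_lt_contravar; [apply Rmult_lt_0_compat|]; lra.
Qed.

Lemma le_zero_of_tol C Y : (forall k, Y <= C * tol k) -> Y <= 0.
Proof.
  intros H; apply Rnot_lt_le; intros P.
  destruct (tol_small (Y / (Rabs C + 1))) as [N HN].
  { apply Rdiv_lt_0_compat; [assumption|]; pose proof (Rabs_pos C); lra. }
  specialize (HN N (le_n N)); specialize (H N).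
  pose proof (Rabs_pos C); pose proof (Rle_abs C); pose proof (tol_pos N).
  apply Rmult_lt_compat_r with (r := Rabs C + 1) in HN; [|lra].
  unfold Rdiv in HN; rewrite Rmult_assoc, Rinv_l in HN by lra. nra.
Qed.

Lemma cv_sumL (u : nat -> list Z -> R) v L : (forall x, In x L -> Un_cv (fun l => u l x) (v x)) ->
  Un_cv (fun l => sumL (u l) L) (sumL v L).
Proof.
  induction L as [|x L IH]; intros H; simpl; [apply null_zero|].
  apply (CV_plus (fun l => u l x) (fun l => sumL (u l) L)); [apply H; now left|].
  apply IH; intros; apply H; now right.
Qed.

Lemma cv_sumR (u : nat -> nat -> R) v N : (forall i, (i < N)%nat -> Un_cv (fun l => u l i) (v i)) ->
  Un_cv (fun l => sumR N (u l)) (sumR N v).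
Proof.
  induction N as [|N IH]; intros H; simpl; [apply null_zero|].
  apply (CV_plus (fun l => sumR N (u l)) (fun l => u l N)); auto.
Qed.

(** Every finite partial sum passes to the limit, and the error [c * tol l] disappears. *)
Lemma fatou d (u : nat -> field) (v : field) C c : (forall l, square_summable d (u l)) ->
  (forall x, valid d x -> Un_cv (fun l => u l x) (v x)) ->
  (forall l, ip d (u l) (u l) <= C + c * tol l) ->
  square_summable d v /\ ip d v v <= C.
Proof.
  intros Su Huv B.
  assert (F : forall L, finset_pts d L -> sumL (fun x => v x * v x) L <= C).
  { intros L FL; apply Rnot_lt_le; intros P; set (s := sumL _ _) in P.
    destruct (cv_sumL (fun l x => u l x * u l x) (fun x => v x * v x) L) with (eps := (s - C) / 2)
      as [N HN]; [|lra|].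
    - intros x Hx; destruct FL as [_ V]; rewrite Forall_forall in V.
      apply (CV_mult (fun l => u l x) (fun l => u l x)); auto.
    - destruct (tol_small ((s - C) / 2 / (Rabs c + 1))) as [N' HN'].
      { apply Rdiv_lt_0_compat; [lra|]; pose proof (Rabs_pos c); lra. }
      set (l := max N N').
      specialize (HN l ltac:(lia)); specialize (HN' l ltac:(lia)); fold s in HN.
      pose proof (ip_ge_list d (u l) L (Su l) FL); specialize (B l).
      unfold Rdist in HN; apply Rabs_def2 in HN.
      pose proof (Rabs_pos c); pose proof (Rle_abs c); pose proof (tol_pos l).
      apply Rmult_lt_compat_r with (r := Rabs c + 1) in HN'; [|lra].
      unfold Rdiv in HN' at 1; rewrite Rmult_assoc, Rinv_l in HN' by lra. nra. }
  assert (Sv : square_summable d v) by (apply summable_bounded with C; auto; intros; nra).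
  split; [assumption|]; eapply has_sum_upper; [exact F|now apply tsum_spec, summable_mul].
Qed.

Lemma exists_infimum (P : R -> Prop) : (exists r, P r) -> (forall r, P r -> 0 <= r) ->
  exists m, (forall r, P r -> m <= r) /\ forall eps, 0 < eps -> exists r, P r /\ r < m + eps.
Proof.
  intros [r0 H0] L.
  destruct (completeness (fun s => P (- s))) as [s [U Lst]].
  - exists 0; intros s Hs; specialize (L _ Hs); lra.
  - exists (- r0); now rewrite Ropp_involutive.
  - exists (- s); split.
    + intros r Hr; assert (- r <= s); [|lra]; apply U; now rewrite Ropp_involutive.
    + intros eps He; apply NNPP; intros N.
      assert (s <= s - eps); [|lra]; apply Lst; intros t Ht; apply Rnot_lt_le; intros Q.
      apply N; exists (- t); split; [assumption|lra].
Qed.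

(* g is the point of the closure of psi - ran (U - 1) of least norm. *)
Lemma iterates_converge_to_projection d psi : sq_state d psi ->
  exists g, sq_state d g /\ agree d (rwalk d g) g /\
    (forall e, sq_state d e -> agree d (rwalk d e) e -> dot d (slin 1 psi (-1) g) e = 0) /\
    (forall x j, valid d x -> (j < Dim d)%nat -> Un_cv (fun n => riter d n psi x j) (g x j)).
Proof.
  intros Hpsi.
  set (res := fun h => slin 1 psi (-1) (slin 1 (rwalk d h) (-1) h)).
  assert (Sres : forall h, sq_state d h -> sq_state d (res h))
    by (intros; unfold res; auto using sq_state_slin, sq_state_rwalk).
  set (N := fun a => dot d a a).
  destruct (exists_infimum (fun r => exists h, sq_state d h /\ r = N (res h))) as [m [Lm Am]].
  { exists (N (res psi)); now exists psi. }
  { intros r [h [Hh ->]]; apply dot_ge0; auto. }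
  assert (Hk : forall k, {h | sq_state d h /\ N (res h) < m + tol k}).
  { intros k; apply constructive_indefinite_description.
    destruct (Am (tol k) (tol_pos k)) as [r [[h [Hh ->]] Hr]]; now exists h. }
  set (h := fun k => proj1_sig (Hk k)).
  assert (Sh : forall k, sq_state d (h k)) by (intros k; apply (proj2_sig (Hk k))).
  assert (Bh : forall k, N (res (h k)) < m + tol k) by (intros k; apply (proj2_sig (Hk k))).
  set (r := fun k => res (h k)).
  assert (Sr : forall k, sq_state d (r k)) by (intros; now apply Sres).
  (* [res] is affine, so a midpoint of two of its values is again a value and has squared norm at
     least [m]. *)
  assert (avg : forall h1 h2, sq_state d h1 -> sq_state d h2 ->
    m <= N (slin (1/2) (res h1) (1/2) (res h2))).
  { intros h1 h2 S1 S2; apply Lm; exists (slin (1/2) h1 (1/2) h2).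
    split; [now apply sq_state_slin|]; f_equal; unfold res; rewrite rwalk_slin.
    apply functional_extensionality; intros x; apply functional_extensionality; intros j.
    unfold slin; field. }
  (* The parallelogram identity makes the minimising sequence Cauchy. *)
  assert (Cr : forall k l, N (slin 1 (r k) (-1) (r l)) <= 2 * tol k + 2 * tol l).
  { intros k l; unfold N; rewrite parallelogram by auto.
    pose proof (avg (h k) (h l) (Sh k) (Sh l)); pose proof (Bh k); pose proof (Bh l).
    unfold N, r in *; lra. }
  assert (Ur : forall k, N (slin 1 (rwalk d (r k)) (-1) (r k)) <= 4 * tol k).
  { intros k; unfold N; rewrite parallelogram by auto using sq_state_rwalk.
    assert (M : m <= N (slin (1/2) (rwalk d (r k)) (1/2) (r k))).
    (* [(U r + r) / 2 = r + (U - 1) r / 2] is again a value of [res], namely at [h - r / 2]. Hence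
       [U r] and [r], of equal norm, are both nearly minimal and close to each other. *)
    { apply Lm; exists (slin 1 (h k) (-1/2) (r k)); split; [now apply sq_state_slin|].
      f_equal; unfold r at 2 3, res; rewrite rwalk_slin.
      apply functional_extensionality; intros x; apply functional_extensionality; intros j.
      fold (res (h k)); fold (r k).
      assert (Q : r k x j = psi x j - (rwalk d (h k) x j - h k x j))
        by (unfold r, res, slin; ring).
      unfold slin; lra. }
    pose proof (Bh k); rewrite (dot_rwalk d (r k)) by auto; unfold N, r in *; lra. }
  set (g := fun x j => epsilon (inhabits 0) (Un_cv (fun k => r k x j))).
  assert (Hg : forall x j, valid d x -> (j < Dim d)%nat -> Un_cv (fun k => r k x j) (g x j)).
  { intros x j Hx Hj; apply epsilon_spec.
    destruct (R_complete (fun k => r k x j)) as [l Hl]; [|now exists l].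
    intros eps He; destruct (tol_small (eps * eps / 4)) as [K HK]; [nra|].
    exists K; intros k l Hk1 Hl1; unfold Rdist.
    pose proof (dot_ge_pt d (slin 1 (r k) (-1) (r l)) x j) as P.
    specialize (P ltac:(auto using sq_state_slin) Hx Hj); specialize (Cr k l); unfold N in Cr.
    pose proof (HK k Hk1); pose proof (HK l Hl1).
    apply Rabs_lt_of_sqr; [assumption|]; unfold slin at 1 2 in P; lra. }
  (* [g] is so far only a pointwise limit; letting [l] grow in [Cr] bounds its distance to [r k] in
     norm. *)
  assert (Fa : forall k j, (j < Dim d)%nat ->
    square_summable d (coord (slin 1 (r k) (-1) g) j) /\
    ip d (coord (slin 1 (r k) (-1) g) j) (coord (slin 1 (r k) (-1) g) j) <= 2 * tol k).
  { intros k j Hj; apply (fatou d (fun l => coord (slin 1 (r k) (-1) (r l)) j) _ _ 2).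
    - intros l; exact (sq_state_slin d 1 (r k) (-1) (r l) (Sr k) (Sr l) j Hj).
    - intros x Hx; unfold coord, slin.
      apply (CV_plus (fun _ => 1 * r k x j) (fun l => -1 * r l x j)).
      + intros eps He; exists 0%nat; intros; unfold Rdist; rewrite Rminus_diag, Rabs_R0; assumption.
      + apply cv_scal; auto.
    - intros l; eapply Rle_trans; [|apply Cr].
      exact (dot_ge_coord d _ j (sq_state_slin d 1 (r k) (-1) (r l) (Sr k) (Sr l)) Hj). }
  assert (Srg : forall k, sq_state d (slin 1 (r k) (-1) g)) by (intros k j Hj; now apply Fa).
  set (D := INR (Dim d)).
  assert (Nrg : forall k, N (slin 1 (r k) (-1) g) <= 2 * D * tol k).
  { intros k; apply Rle_trans with (sumR (Dim d) (fun _ => 2 * tol k)).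
    - apply sumR_le; intros j Hj; now apply Fa.
    - rewrite sumR_const; unfold D; lra. }
  assert (Sg : sq_state d g).
  (* [g = r_0 - (r_0 - g)], a difference of two square-summable states. *)
  { replace g with (slin 1 (r 0%nat) (-1) (slin 1 (r 0%nat) (-1) g)); [now apply sq_state_slin|].
    apply functional_extensionality; intros x; apply functional_extensionality; intros j.
    unfold slin; ring. }
  assert (Fg : agree d (rwalk d g) g).
  { intros x j Hx Hj.
    assert (Z : (rwalk d g x j - g x j) * (rwalk d g x j - g x j) <= 0).
    (* [U g - g] is the sum of [- U (r_k - g)], [U r_k - r_k] and [r_k - g], with squared norms at
       most [2 D], 4 and [2 D] times [tol k]; the factor 3 bounds the square of a sum of three
       terms. *)
    { apply le_zero_of_tol with (3 * (2 * D + 4 + 2 * D)); intros k.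
      pose proof (dot_ge_pt d (slin 1 (r k) (-1) g) x j (Srg k) Hx Hj) as P1.
      pose proof (dot_ge_pt d (rwalk d (slin 1 (r k) (-1) g)) x j
        (sq_state_rwalk d _ (Srg k)) Hx Hj) as P2.
      rewrite dot_rwalk in P2 by auto.
      pose proof (dot_ge_pt d _ x j (sq_state_slin d 1 (rwalk d (r k)) (-1) (r k)
        (sq_state_rwalk d _ (Sr k)) (Sr k)) Hx Hj) as P3.
      specialize (Nrg k); specialize (Ur k); unfold N in Nrg, Ur.
      rewrite rwalk_slin in P2.
      set (A := slin 1 (r k) (-1) g x j) in *.
      set (B := slin 1 (rwalk d (r k)) (-1) (rwalk d g) x j) in *.
      set (C := slin 1 (rwalk d (r k)) (-1) (r k) x j) in *.
      assert (E : rwalk d g x j - g x j = - B + C + A) by (unfold A, B, C, slin; ring).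
      rewrite E; apply Rle_trans with (3 * (B * B + C * C + A * A)); [|lra].
      pose proof (Rle_0_sqr (B + C)); pose proof (Rle_0_sqr (B + A)); pose proof (Rle_0_sqr (C - A)).
      unfold Rsqr in *; clear - H H0 H1; lra. }
    clear - Z; nra. }
  exists g; repeat split; auto.
  - intros e Se Fe; set (X := dot d _ e).
    (* [U] preserves [dot] and fixes [e], so [(U - 1) h] is orthogonal to [e] and [r k] may replace
       [psi]. *)
    assert (EX : forall k, dot d (slin 1 (r k) (-1) g) e = X).
    { intros k; unfold X, r, res; rewrite !dot_slinl by auto using sq_state_slin, sq_state_rwalk.
      assert (U : dot d (rwalk d (h k)) e = dot d (h k) e); [|rewrite U; ring].
      rewrite <- (dot_rwalk d (h k) e) by auto; apply dot_agree; intros x j Hx Hj;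
        [reflexivity|symmetry; now apply Fe]. }
    (* The square of [t (r_k - g) + e] is nonnegative; as [r_k - g] tends to 0 in norm, only the
       part affine in [t] survives, and an affine function bounded below is constant. *)
    assert (Q : forall t, - (2 * t * X + dot d e e) <= 0).
    { intros t; apply le_zero_of_tol with (t * t * (2 * D)); intros k.
      pose proof (dot_ge0 d (slin t (slin 1 (r k) (-1) g) 1 e)) as P.
      specialize (P ltac:(auto using sq_state_slin)).
      rewrite dot_slin_sq, EX in P by auto.
      specialize (Nrg k); unfold N in Nrg.
      apply (Rmult_le_compat_l (t * t)) in Nrg; [lra|apply Rle_0_sqr]. }
    pose proof (dot_ge0 d e Se).
    destruct (Req_dec X 0) as [|NX]; [assumption|].
    (* This [t] gives the affine function the value -1. *)
    specialize (Q (- (dot d e e + 1) / (2 * X))).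
    replace (2 * (- (dot d e e + 1) / (2 * X)) * X) with (- (dot d e e + 1)) in Q by (field; assumption).
    lra.
  - intros x j Hx Hj eps He.
    destruct (tol_small (eps / 2 * (eps / 2) / (2 * D))) as [k Hk0].
    { apply Rdiv_lt_0_compat; [nra|]; pose proof (Dim_pos d); unfold D; lra. }
    specialize (Hk0 k (le_n k)).
    destruct (increment_decay d (h k) x j (Sh k) Hx Hj (eps / 2) ltac:(lra)) as [K HK].
    exists K; intros n Hn; specialize (HK n Hn).
    pose proof (dot_ge_pt d (riter d n (slin 1 (r k) (-1) g)) x j
      (sq_state_riter d n _ (Srg k)) Hx Hj) as P.
    rewrite dot_riter in P by auto; specialize (Nrg k); unfold N in Nrg.
    set (A := riter d n (slin 1 (r k) (-1) g) x j) in *.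
    assert (BA : Rabs A < eps / 2).
    { apply Rabs_lt_of_sqr; [lra|].
      assert (PD : 0 < 2 * D) by (pose proof (Dim_pos d); unfold D; lra).
      apply Rmult_lt_compat_l with (r := 2 * D) in Hk0; [|assumption].
      replace (2 * D * (eps / 2 * (eps / 2) / (2 * D))) with (eps / 2 * (eps / 2)) in Hk0
        by (field; lra). lra. }
    unfold Rdist in *; rewrite Rminus_0_r in HK.
    (* Since [psi = r_k + (U - 1) h_k] and [U g = g], the error is
       [(U^(n+1) - U^n) h_k + U^n (r_k - g)]: the first term tends to 0 at each site, the second is
       small uniformly in [n]. *)
    assert (E : riter d n psi x j - g x j
      = (riter d (n + 1) (h k) x j - riter d n (h k) x j) + A).
    { rewrite <- (riter_fixed d g n Fg x j Hx Hj), riter_succ_r.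
      unfold A, r, res; rewrite !riter_slin; unfold slin; ring. }
    rewrite E; eapply Rle_lt_trans; [apply Rabs_triang|]; lra.
Qed.

(** * Complex states and the eigenvector for 1 *)

Definition re_part (psi : state) : rstate := fun x j => Re (psi x j).
Definition im_part (psi : state) : rstate := fun x j => Im (psi x j).

Lemma Re_sumC n f : Re (sumC n f) = sumR n (fun j => Re (f j)).
Proof. induction n; simpl; [reflexivity|]; now rewrite IHn. Qed.

Lemma Im_sumC n f : Im (sumC n f) = sumR n (fun j => Im (f j)).
Proof. induction n; simpl; [reflexivity|]; now rewrite IHn. Qed.

Lemma Cx_eq a b : Re a = Re b -> Im a = Im b -> a = b.
Proof. destruct a, b; simpl; congruence. Qed.

Lemma re_part_Ulazy d psi : re_part (Ulazy d psi) = rwalk d (re_part psi).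
Proof.
  apply functional_extensionality; intros x; apply functional_extensionality; intros j.
  unfold re_part, rwalk, Ulazy, grover; simpl; rewrite Re_sumC; reflexivity.
Qed.

Lemma im_part_Ulazy d psi : im_part (Ulazy d psi) = rwalk d (im_part psi).
Proof.
  apply functional_extensionality; intros x; apply functional_extensionality; intros j.
  unfold im_part, rwalk, Ulazy, grover; simpl; rewrite Im_sumC; reflexivity.
Qed.

Lemma re_part_Uiter d n psi : re_part (Uiter d n psi) = riter d n (re_part psi).
Proof. induction n; [reflexivity|]; simpl; rewrite re_part_Ulazy; now f_equal. Qed.

Lemma im_part_Uiter d n psi : im_part (Uiter d n psi) = riter d n (im_part psi).
Proof. induction n; [reflexivity|]; simpl; rewrite im_part_Ulazy; now f_equal. Qed.

Lemma sumL_sumR N (F : nat -> list Z -> R) L :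
  sumL (fun x => sumR N (fun j => F j x)) L = sumR N (fun j => sumL (F j) L).
Proof.
  induction L as [|x L IH]; simpl.
  - rewrite sumR_const; ring.
  - rewrite IH.
    rewrite <- (Rmult_1_l (sumR N (fun j => F j x))), <- (Rmult_1_l (sumR N (fun j => sumL _ L))).
    rewrite <- sumR_lin; apply sumR_ext; intros; ring.
Qed.

Lemma l2_iff d psi : l2 d psi <-> sq_state d (re_part psi) /\ sq_state d (im_part psi).
Proof.
  split.
  - intros [M HM].
    assert (B : forall f : field, (forall j, (j < Dim d)%nat -> forall x, f x * f x <= vnorm2 (Dim d) (psi x))
       -> (0 < Dim d)%nat -> square_summable d f).
    { intros f Hf P; apply summable_bounded with M; [intros; nra|].
      intros L FL; eapply Rle_trans; [|exact (HM L FL)].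
      apply sumL_le with d; [intros; eapply Hf; eassumption|apply FL]. }
    assert (T : forall j x, (j < Dim d)%nat -> Cnorm2 (psi x j) <= vnorm2 (Dim d) (psi x)).
    { intros j x Hj; apply (sumR_ge_term (Dim d) (fun j => Cnorm2 (psi x j))); [|assumption].
      intros; unfold Cnorm2; nra. }
    split; intros j Hj; apply B; try lia; intros _ _ x; specialize (T j x Hj);
      unfold coord, re_part, im_part, Cnorm2 in *; nra.
  - intros [HR HI]; exists (dot d (re_part psi) (re_part psi) + dot d (im_part psi) (im_part psi)).
    intros L FL; unfold vnorm2; rewrite sumL_sumR; unfold dot.
    rewrite <- (Rmult_1_l (sumR (Dim d) (fun j => ip d (coord (re_part psi) j) _))).
    rewrite <- (Rmult_1_l (sumR (Dim d) (fun j => ip d (coord (im_part psi) j) _))).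
    rewrite <- sumR_lin; apply sumR_le; intros j Hj.
    transitivity (sumL (fun x => 1 * (re_part psi x j * re_part psi x j)
      + 1 * (im_part psi x j * im_part psi x j)) L).
    { right; apply sumL_ext with d; [|apply FL].
      intros; unfold Cnorm2, re_part, im_part; ring. }
    rewrite sumL_lin; apply Rplus_le_compat; apply Rmult_le_compat_l; try lra;
      [apply (ip_ge_list d (coord (re_part psi) j))|apply (ip_ge_list d (coord (im_part psi) j))]; auto.
Qed.

Lemma has_sum_sumR d N F s : (forall j, (j < N)%nat -> has_sum d (F j) (s j)) ->
  has_sum d (fun x => sumR N (fun j => F j x)) (sumR N s).
Proof.
  induction N as [|N IH]; intros H.
  - intros eps He; exists nil; repeat split; try constructor; intros L _ _.
    rewrite sumL_sumR; simpl; rewrite Rminus_0_r, Rabs_R0; assumption.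
  - simpl; rewrite <- (Rmult_1_l (sumR N s)), <- (Rmult_1_l (s N)).
    eapply has_sum_ext; [|exact (has_sum_lin d 1 1 _ _ _ _ (IH (fun j h => H j (Nat.lt_lt_succ_r _ _ h)))
      (H N (Nat.lt_succ_diag_r N)))].
    intros; simpl; ring.
Qed.

Lemma has_sum_dot d a b : sq_state d a -> sq_state d b ->
  has_sum d (fun x => sumR (Dim d) (fun j => a x j * b x j)) (dot d a b).
Proof.
  intros Ha Hb; apply (has_sum_sumR d (Dim d) (fun j x => a x j * b x j)); intros j Hj.
  apply (tsum_spec d (fun x => coord a j x * coord b j x)), summable_mul; auto.
Qed.

Lemma eigenspace_one_iff d psi : eigenspace d Cone psi <->
  sq_state d (re_part psi) /\ sq_state d (im_part psi) /\
  agree d (rwalk d (re_part psi)) (re_part psi) /\ agree d (rwalk d (im_part psi)) (im_part psi).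
Proof.
  unfold eigenspace; rewrite l2_iff, <- re_part_Ulazy, <- im_part_Ulazy; split.
  - intros [[HR HI] E]; repeat split; auto; intros x j Hx Hj; unfold re_part, im_part;
      rewrite E by assumption; simpl; ring.
  - intros (HR & HI & ER & EI); repeat split; auto; intros x j Hx Hj.
    specialize (ER x j Hx Hj); specialize (EI x j Hx Hj); unfold re_part, im_part in *.
    apply Cx_eq; [rewrite ER|rewrite EI]; simpl; ring.
Qed.

(** * A finitely supported eigenvector for 1 *)

Lemma square_summable_finite_support d (f : field) C :
  (forall x, valid d x -> f x <> 0 -> In x C) -> square_summable d f.
Proof.
  intros HC; set (F := fun x => f x * f x).
  set (dec := fun x => if in_dec (list_eq_dec Z.eq_dec) x C then true else false).
  (* [C] may repeat points or contain lists of another length, so it is cleaned before serving as a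
     finite set of sites. *)
  set (C' := nodup (list_eq_dec Z.eq_dec) (filter (fun x => Nat.eqb (length x) d) C)).
  assert (FC : finset_pts d C').
  { split; [apply NoDup_nodup|]; apply Forall_forall; intros x Hx.
    apply nodup_In, filter_In in Hx; now apply Nat.eqb_eq. }
  assert (P : forall x, valid d x -> 0 <= F x) by (intros; unfold F; nra).
  apply summable_bounded with (sumL F C'); [exact P|]; intros L FL.
  assert (E : sumL F L = sumL F (filter dec L)).
  { destruct FL as [_ V]; induction V as [|x L Hx V IH]; simpl; [reflexivity|].
    unfold dec at 1; destruct (in_dec _ x C) as [|N]; simpl; rewrite IH; [reflexivity|].
    assert (F0 : F x = 0) by (unfold F; replace (f x) with 0; [ring|symmetry; apply NNPP; auto]).
    rewrite F0; ring. }
  fold F; rewrite E; apply (sumL_incl d F P); [|assumption|].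
  - destruct FL as [NL VL]; split; [now apply NoDup_filter|].
    rewrite Forall_forall in *; intros x Hx; apply filter_In in Hx; now apply VL.
  - destruct FL as [_ VL]; rewrite Forall_forall in VL; intros x Hx; apply filter_In in Hx.
    destruct Hx as [Hx Hd]; unfold dec in Hd; destruct (in_dec _ x C) as [HxC|]; [|discriminate].
    apply nodup_In, filter_In; split; [assumption|]; now apply Nat.eqb_eq, VL.
Qed.

Definition bit (z : Z) : R := if (Z.eqb z 0 || Z.eqb z 1)%bool then 1 else 0.
Definition cube (x : list Z) : R := fold_right (fun z r => bit z * r) 1 x.
(** On the cube, direction [+i] has amplitude 2 on the face [x_i = 1] and direction [-i] has
    amplitude 2 on the face [x_i = 0]. Each pair thus adds up to [2 * cube x], which makes the mean
    equal to [cube x]. *)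
Definition cube_mode (d : nat) : rstate := fun x j =>
  if Nat.ltb j d then 2 * cube x * IZR (nth j x 0%Z)
  else if Nat.eqb j d then cube x
  else 2 * cube x * (1 - IZR (nth (j - d - 1) x 0%Z)).

Fixpoint cube_points (d : nat) : list (list Z) :=
  match d with
  | O => [nil]
  | S k => map (cons 0%Z) (cube_points k) ++ map (cons 1%Z) (cube_points k)
  end.

Lemma cube_support x : cube x <> 0 -> In x (cube_points (length x)).
Proof.
  induction x as [|z x IH]; simpl; [now left|]; intros H.
  assert (Hx : cube x <> 0) by (intros E; apply H; rewrite E; ring).
  apply in_or_app; unfold bit in H.
  destruct (Z.eqb_spec z 0) as [->|]; [left; now apply in_map, IH|].
  destruct (Z.eqb_spec z 1) as [->|]; [right; now apply in_map, IH|].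
  exfalso; apply H; simpl; ring.
Qed.

(** The factors [2 - z] and [z] remove the end values [z = 2] and [z = 0], leaving [z = 1] on both
    sides. This is the fixed-point equation in one coordinate. *)
Lemma bit_pred z : bit (z + -1) * (2 - IZR z) = bit z * IZR z.
Proof.
  unfold bit.
  destruct (Z.eqb_spec z 0) as [->|]; [simpl; ring|].
  destruct (Z.eqb_spec z 1) as [->|]; [simpl; ring|].
  destruct (Z.eqb_spec (z + -1) 0); [lia|].
  destruct (Z.eqb_spec (z + -1) 1); [replace z with 2%Z by lia|]; simpl; ring.
Qed.

Lemma cube_pred x i : (i < length x)%nat ->
  cube (upd x i (-1)) * (2 - IZR (nth i x 0%Z)) = cube x * IZR (nth i x 0%Z).
Proof.
  revert i; induction x as [|z x IH]; intros i Hi; simpl in Hi; [lia|].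
  destruct i as [|i]; simpl.
  - transitivity (bit (z + -1) * (2 - IZR z) * cube x); [ring|rewrite bit_pred; ring].
  - specialize (IH i ltac:(lia)). rewrite !Rmult_assoc, IH; reflexivity.
Qed.

Lemma cube_mode_forward d x i : (i < d)%nat -> cube_mode d x i = 2 * cube x * IZR (nth i x 0%Z).
Proof. intros H; unfold cube_mode; apply Nat.ltb_lt in H; now rewrite H. Qed.

Lemma cube_mode_rest d x : cube_mode d x d = cube x.
Proof. unfold cube_mode; now rewrite Nat.ltb_irrefl, Nat.eqb_refl. Qed.

Lemma cube_mode_backward d x i :
  cube_mode d x (d + 1 + i)%nat = 2 * cube x * (1 - IZR (nth i x 0%Z)).
Proof.
  unfold cube_mode; destruct (Nat.ltb_spec (d + 1 + i) d); [lia|].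
  destruct (Nat.eqb_spec (d + 1 + i) d); [lia|].
  replace (d + 1 + i - d - 1)%nat with i by lia; reflexivity.
Qed.

Lemma mean_cube_mode d x : mean d (cube_mode d) x = cube x.
Proof.
  unfold mean, mul, fsum, coord; rewrite sumR_Dim, cube_mode_rest.
  assert (E : sumR d (cube_mode d x) + sumR d (fun i => cube_mode d x (d + 1 + i)%nat)
    = INR d * (2 * cube x)).
  { rewrite <- sumR_const.
    transitivity (1 * sumR d (cube_mode d x) + 1 * sumR d (fun i => cube_mode d x (d + 1 + i)%nat));
      [ring|].
    rewrite <- sumR_lin; apply sumR_ext; intros i Hi.
    rewrite cube_mode_forward, cube_mode_backward by assumption; ring. }
  change (sumR d (fun i => cube_mode d x i)) with (sumR d (cube_mode d x)).
  replace (sumR d (cube_mode d x) + cube x + sumR d (fun i => cube_mode d x (d + 1 + i)%nat))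
    with (INR (Dim d) * cube x).
  - field; pose proof (Dim_pos d); lra.
  - unfold Dim; rewrite plus_INR, mult_INR; simpl INR; lra.
Qed.

Lemma cube_mode_fixed d : agree d (rwalk d (cube_mode d)) (cube_mode d).
Proof.
  intros x j Hx Hj; unfold valid in Hx; destruct (Dim_cases d j Hj) as [Hi|[->|[i [Hi ->]]]].
  - rewrite rwalk_forward, mean_cube_mode, !cube_mode_forward, nth_upd_same, plus_IZR by lia.
    pose proof (cube_pred x j ltac:(lia)); lra.
  - rewrite rwalk_rest, mean_cube_mode, cube_mode_rest; ring.
  - rewrite rwalk_backward, mean_cube_mode, !cube_mode_backward, nth_upd_same, plus_IZR by lia.
    (* The backward equation at [x] is the forward relation between [x] and [x + u_i]. *)
    pose proof (cube_pred (upd x i 1) i ltac:(rewrite upd_length; lia)) as P.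
    rewrite upd_upd, upd_zero, nth_upd_same, plus_IZR in P by lia; lra.
Qed.

Lemma sq_state_cube_mode d : sq_state d (cube_mode d).
Proof.
  intros j _; apply square_summable_finite_support with (cube_points d).
  intros x Hx N; unfold valid in Hx; rewrite <- Hx; apply cube_support; intros E; apply N.
  unfold coord, cube_mode; rewrite E.
  destruct (Nat.ltb j d); [ring|]; destruct (Nat.eqb j d); ring.
Qed.

Lemma sq_state_zero d : sq_state d (fun _ _ => 0).
Proof. intros j _; apply square_summable_zero. Qed.

Lemma rwalk_zero d : agree d (rwalk d (fun _ _ => 0)) (fun _ _ => 0).
Proof. intros x j _ _; unfold rwalk; rewrite sumR_const; ring. Qed.

Lemma cube_origin d : cube (origin d) = 1.
Proof.
  unfold origin; induction d as [|d IH]; simpl; [reflexivity|].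
  rewrite IH; unfold bit; simpl; ring.
Qed.

Lemma one_is_eigenvalue d : is_eigenvalue d Cone.
Proof.
  exists (fun x j => mkCx (cube_mode d x j) 0); split.
  - apply eigenspace_one_iff; repeat split;
      auto using sq_state_cube_mode, sq_state_zero, cube_mode_fixed, rwalk_zero.
  - exists (origin d), d; repeat split.
    + apply repeat_length.
    + unfold Dim; lia.
    + intros E; apply (f_equal Re) in E; simpl in E.
      rewrite cube_mode_rest, cube_origin in E; lra.
Qed.

(** * Exclusion of other eigenvalues and the limit theorem *)

Lemma riter_agree d a b n : agree d a b -> agree d (riter d n a) (riter d n b).
Proof. intros H; induction n; [assumption|]; now apply rwalk_agree. Qed.

(** By the isometry [|lam| = 1], so the modulus of the eigenvector at a site stays constant under
    iteration, and its squared increment there is the constant [|lam - 1|^2 |psi(x)_j|^2]. This must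
    tend to 0 by [increment_decay]. *)
Lemma eigenvalue_is_one d lam : is_eigenvalue d lam -> lam = Cone.
Proof.
  destruct lam as [lr li]; intros [psi [[HL E] [x [j [Hx [Hj NZ]]]]]].
  apply l2_iff in HL as [SP SQ].
  set (P := re_part psi) in *; set (Q := im_part psi) in *.
  assert (EP : agree d (rwalk d P) (slin lr P (- li) Q)).
  { unfold P at 1; rewrite <- re_part_Ulazy; intros y i Hy Hi; unfold re_part.
    rewrite E by assumption; unfold slin, P, Q, re_part, im_part; simpl; ring. }
  assert (EQ : agree d (rwalk d Q) (slin lr Q li P)).
  { unfold Q at 1; rewrite <- im_part_Ulazy; intros y i Hy Hi; unfold im_part.
    rewrite E by assumption; unfold slin, P, Q, re_part, im_part; simpl; ring. }
  assert (pos : 0 < P x j * P x j + Q x j * Q x j).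
  { destruct (Req_dec (P x j) 0) as [p0|]; [|nra].
    destruct (Req_dec (Q x j) 0) as [q0|]; [|nra].
    exfalso; apply NZ, Cx_eq; assumption. }
  assert (mod1 : lr * lr + li * li = 1).
  { pose proof (dot_rwalk d P P SP SP) as NP; pose proof (dot_rwalk d Q Q SQ SQ) as NQ.
    rewrite (dot_agree d _ _ _ _ EP EP), dot_slinl, !dot_slinr in NP by auto using sq_state_slin.
    rewrite (dot_agree d _ _ _ _ EQ EQ), dot_slinl, !dot_slinr in NQ by auto using sq_state_slin.
    pose proof (dot_ge_pt d P x j SP Hx Hj); pose proof (dot_ge_pt d Q x j SQ Hx Hj).
    rewrite (dot_sym d Q P) in *.
    (* In the sum of the two isometry identities the cross terms cancel, leaving [|lam|^2] times the
       squared norm, which is positive. *)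
    apply Rmult_eq_reg_r with (dot d P P + dot d Q Q); lra. }
  set (p := fun n => riter d n P x j); set (q := fun n => riter d n Q x j).
  assert (p1 : forall n, p (n + 1)%nat = lr * p n - li * q n).
  { intros n; unfold p, q; rewrite riter_succ_r, (riter_agree d _ _ n EP x j Hx Hj), riter_slin.
    unfold slin; ring. }
  assert (q1 : forall n, q (n + 1)%nat = lr * q n + li * p n).
  { intros n; unfold p, q; rewrite riter_succ_r, (riter_agree d _ _ n EQ x j Hx Hj), riter_slin.
    unfold slin; ring. }
  assert (cst : forall n, p n * p n + q n * q n = P x j * P x j + Q x j * Q x j).
  { induction n as [|n IH]; [reflexivity|].
    rewrite <- Nat.add_1_r, p1, q1, <- IH.
    transitivity ((lr * lr + li * li) * (p n * p n + q n * q n)); [ring|rewrite mod1; ring]. }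
  assert (Lim : null (fun _ => ((lr - 1) * (lr - 1) + li * li) * (P x j * P x j + Q x j * Q x j))).
  { eapply null_ext; [|exact (null_lin 1 _ 1 _
      (null_mul_self _ (increment_decay d P x j SP Hx Hj))
      (null_mul_self _ (increment_decay d Q x j SQ Hx Hj)))].
    intros n; cbv beta; fold (p n) (q n) (p (n + 1)%nat) (q (n + 1)%nat).
    rewrite p1, q1, <- (cst n); ring. }
  assert (Z : ((lr - 1) * (lr - 1) + li * li) * (P x j * P x j + Q x j * Q x j) = 0).
  { apply (UL_sequence (fun _ => ((lr - 1) * (lr - 1) + li * li) * (P x j * P x j + Q x j * Q x j)));
      [|exact Lim].
    intros eps He; exists 0%nat; intros; unfold Rdist; rewrite Rminus_diag, Rabs_R0; assumption. }
  apply Rmult_integral in Z as [Z|Z]; [|lra].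
  apply Cx_eq; simpl; nra.
Qed.

Lemma sq_state_delta0 d phi (part : Cx -> R) : part Czero = 0 ->
  sq_state d (fun x j => part (delta0 d phi x j)).
Proof.
  intros H0 j _; apply square_summable_finite_support with [origin d].
  intros x _; unfold coord, delta0; destruct (list_eq_dec Z.eq_dec x (origin d)); [now left|].
  intros N; now contradiction N.
Qed.

Theorem mainTheorem3 (d : nat) (hd : (1 <= d)%nat) :
  is_eigenvalue d Cone /\
  (forall lam : Cx, is_eigenvalue d lam -> lam = Cone) /\
  (forall (phi : vec) (x : list Z), valid d x ->
     exists g : state,
       is_orth_proj d (eigenspace d Cone) (delta0 d phi) g /\
       Un_cv (fun n => vnorm2 (Dim d) (Uiter d n (delta0 d phi) x))
             (vnorm2 (Dim d) (g x))).
Proof.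
  split; [apply one_is_eigenvalue|]; split; [apply eigenvalue_is_one|].
  intros phi x Hx; set (psi := delta0 d phi).
  assert (SP : sq_state d (re_part psi)) by now apply sq_state_delta0.
  assert (SQ : sq_state d (im_part psi)) by now apply sq_state_delta0.
  destruct (iterates_converge_to_projection d _ SP) as (p & Sp & Fp & Op & Lp).
  destruct (iterates_converge_to_projection d _ SQ) as (q & Sq & Fq & Oq & Lq).
  (* The projection is taken separately on real and imaginary parts, since [U] is real. *)
  exists (fun y j => mkCx (p y j) (q y j)); split; [split|].
  - apply eigenspace_one_iff; auto.
  - intros e He; apply eigenspace_one_iff in He as (Sr & Si & Fr & Fi).
    pose proof (Op _ Sr Fr) as Orr; pose proof (Op _ Si Fi) as Ori.
    pose proof (Oq _ Sr Fr) as Oir; pose proof (Oq _ Si Fi) as Oii.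
    assert (Tp : sq_state d (slin 1 (re_part psi) (-1) p)) by now apply sq_state_slin.
    assert (Tq : sq_state d (slin 1 (im_part psi) (-1) q)) by now apply sq_state_slin.
    split; simpl.
    (* The real part of the complex inner product pairs like parts; the imaginary part, treated
       next, pairs unlike ones with signs -1 and 1. All four real pairings vanish. *)
    + replace 0 with (1 * 0 + 1 * 0) by ring.
      rewrite <- Orr at 1; rewrite <- Oii.
      eapply has_sum_ext; [|apply has_sum_lin; now apply has_sum_dot].
      intros y _; cbv beta; rewrite Re_sumC, <- sumR_lin; apply sumR_ext; intros j _.
      unfold slin, re_part, im_part; simpl; ring.
    + replace 0 with ((-1) * 0 + 1 * 0) by ring.
      rewrite <- Ori at 1; rewrite <- Oir.
      eapply has_sum_ext; [|apply has_sum_lin; now apply has_sum_dot].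
      intros y _; cbv beta; rewrite Im_sumC, <- sumR_lin; apply sumR_ext; intros j _.
      unfold slin, re_part, im_part; simpl; ring.
  - unfold vnorm2.
    apply (cv_sumR (fun n j => Cnorm2 (Uiter d n psi x j)) (fun j => Cnorm2 (mkCx (p x j) (q x j)))).
    intros j Hj; specialize (Lp x j Hx Hj); specialize (Lq x j Hx Hj).
    unfold Cnorm2; simpl.
    pose proof (CV_plus _ _ _ _ (CV_mult _ _ _ _ Lp Lp) (CV_mult _ _ _ _ Lq Lq)) as T.
    intros eps He; destruct (T eps He) as [N HN]; exists N; intros n Hn; specialize (HN n Hn).
    rewrite <- re_part_Uiter, <- im_part_Uiter in HN; exact HN.
Qed.
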